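(* Let $N \geq 2$ be an integer. The following statements hold. (a) There exist real Banach spaces $X_1,\ldots,X_N$ such that the unit ball of the projective tensor product $X_1 \widetilde{\otimes}_\pi \cdots \widetilde{\otimes}_\pi X_N$ contains an exposed point which is not elementary, i.e. not of the form $x_1 \otimes \cdots \otimes x_N$ with $x_i \in X_i$ for $i=1,\dots,N$. (b) There exists a real Banach space $F_N$ such that the unit ball of the symmetric projective tensor product $\widetilde{\otimes}_{\pi_s}^{N,s} F_N$ contains an exposed point which is not of the form $\pm z^{\otimes N}$ with $z \in F_N$.
   Context: All Banach spaces are real. The projective tensor product $X_1 \widetilde{\otimes}_\pi \cdots \widetilde{\otimes}_\pi X_N$ is the completion of the algebraic tensor product $X_1 \otimes \cdots \otimes X_N$ with respect to $\|u\|_\pi = \inf\{\sum_{j=1}^n \|x_{1,j}\| \cdots \|x_{N,j}\| : u = \sum_{j=1}^n x_{1,j} \otimes \cdots \otimes x_{N,j},\ n \in \mathbb{N}\}$. For a Banach space $F$, $\bigotimes^{N,s} F$ is the linear span of the elements $z^{\otimes N} = z \otimes \cdots \otimes z$ ($z \in F$); the symmetric projective norm on it is $\|u\|_{\pi_s} = \inf\{\sum_{j=1}^n |\lambda_j|\,\|x_j\|^N : u = \sum_{j=1}^n \lambda_j x_j^{\otimes N},\ n \in \mathbb{N}\}$, and $\widetilde{\otimes}_{\pi_s}^{N,s} F$ is the completion. A point $x$ of a convex subset $A$ of a Banach space $E$ is an exposed point of $A$ if there is $f \in E^*$ with $f(x) > f(y)$ for every $y \in A \setminus \{x\}$. *)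

(* Defs.v *)
From HB Require Import structures.
From mathcomp Require Import all_boot all_order all_algebra.
From mathcomp Require Import all_classical all_reals all_analysis.
Set Implicit Arguments.
Unset Strict Implicit.
Unset Printing Implicit Defensive.
Import Order.TTheory GRing.Theory Num.Theory.
Import numFieldNormedType.Exports.
Local Open Scope classical_set_scope.
Local Open Scope ring_scope.

Section LinearSpan.
Variables (R : realType) (V : lmodType R) (S : set V).

Definition in_span : {pred V} := fun u =>
  `[< exists (n : nat) (c : 'I_n -> R) (v : 'I_n -> V),
        (forall j, S (v j)) /\ u = \sum_(j < n) c j *: v j >].

Lemma in_span_submod_closed : submod_closed in_span.
Proof.
split.
  apply/asboolP; exists 0%N, (fun=> 0), (fun=> 0).
  by split; [case | rewrite big_ord0].
move=> a u w /asboolP[n [c [v [Sv ->]]]] /asboolP[m [d [z [Sz ->]]]].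
apply/asboolP; exists (n + m)%N.
exists (fun j => match fintype.split j with inl k => a * c k | inr k => d k end).
exists (fun j => match fintype.split j with inl k => v k | inr k => z k end).
split; first by move=> j; case: (fintype.split j).
rewrite big_split_ord scaler_sumr; congr (_ + _); apply: eq_bigr => k _ /=.
  by rewrite (unsplitK (inl k)) scalerA.
by rewrite (unsplitK (inr k)).
Qed.

HB.instance Definition _ :=
  GRing.isSubmodClosed.Build R V in_span in_span_submod_closed.

(* The linear span of [S], as a vector space. *)
Record span_of := Span { span_val : V; span_valP : span_val \in in_span }.

HB.instance Definition _ := [isSub for span_val].
HB.instance Definition _ := [Choice of span_of by <:].
HB.instance Definition _ := [SubChoice_isSubLmodule of span_of by <:].

Lemma in_span_gen (v : V) : S v -> v \in in_span.
Proof.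
move=> Sv; apply/asboolP; exists 1%N, (fun=> 1), (fun=> v).
by split=> //; rewrite big_ord1 scale1r.
Qed.

Definition span_gen (v : V) (Sv : S v) : span_of := Span (in_span_gen Sv).

End LinearSpan.

Section TensorProduct.
Variables (R : realType) (N : nat) (X : 'I_N -> completeNormedModType R).

(* [dfwith x y] is the family [x] with its [i]-th entry replaced by [y : X i];
   no continuity is required. *)
Record multilinear_form := MultilinearForm {
  mform_val :> (forall i, X i) -> R;
  mform_linear : forall (x : forall i, X i) (i : 'I_N),
    linear (fun y : X i => mform_val (dfwith x i y) : R^o) }.

(* Tensors are realized as functionals on multilinear forms, x_1 ⊗ ... ⊗ x_N
   being evaluation at (x_1, ..., x_N): a formal sum of elementary tensors is
   zero iff every multilinear form vanishes on it. *)
Definition eval_form (x : forall i, X i) : multilinear_form -> R^o :=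
  fun B => B x.

(* Algebraic tensor product X_1 ⊗ ... ⊗ X_N *)
Definition tensor := span_of (range eval_form).

Definition pure_tensor (x : forall i, X i) : tensor :=
  span_gen (imageT eval_form x).

Definition proj_norm (u : tensor) : R :=
  inf [set s | exists (n : nat) (x : 'I_n -> forall i, X i),
         u = \sum_(j < n) pure_tensor (x j) /\
         s = \sum_(j < n) \prod_(i < N) `|x j i| ].

End TensorProduct.

Section SymmetricTensorProduct.
Variables (R : realType) (N : nat) (F : completeNormedModType R).

Definition tensor_power (z : F) : tensor (fun _ : 'I_N => F) :=
  pure_tensor (fun _ : 'I_N => z).

Definition sym_tensor := span_of (range tensor_power).

Definition sym_power (z : F) : sym_tensor :=
  span_gen (imageT tensor_power z).

Definition sym_proj_norm (u : sym_tensor) : R :=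
  inf [set s | exists (n : nat) (c : 'I_n -> R) (x : 'I_n -> F),
         u = \sum_(j < n) c j *: sym_power (x j) /\
         s = \sum_(j < n) `|c j| * `|x j| ^+ N ].

End SymmetricTensorProduct.

(* [T], together with the isometric embedding [iota], is a completion of
   [(V, nrm)]; it is unique up to isometric isomorphism. *)
Definition is_completion (R : realType) (V : lmodType R) (nrm : V -> R)
    (T : completeNormedModType R) (iota : {linear V -> T}) : Prop :=
  (forall u : V, `|iota u| = nrm u) /\ dense (range iota).

Definition unit_ball (R : realType) (E : normedModType R) : set E :=
  [set x | `|x| <= 1].

Definition exposed_point (R : realType) (E : normedModType R) (A : set E)
    (x : E) : Prop :=
  A x /\ exists f : {linear E -> R^o},
    continuous f /\ forall y : E, A y -> y <> x -> f y < f x.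

(* Main.v *)
(** Fix [n = N + 1]. The space [F] is the completion of the span of the matrix
    units and of the vectors [p(s, m) = z_s + phi_m], where [z_s] is the
    permutation matrix of [s] in [S_n] and [phi_m] is the indicator of [0, m];
    its unit ball is the closed absolutely convex hull of the vectors
    [p(s, m) / (1 + 1/(m+1))] and of the halves of the matrix units. As [m] grows,
    [p(s, m)] approaches the unit sphere without converging in [F]. However
    [u = sum_s (sgn s / n!) p(s, m)^{⊗N}] does not depend on [m], because a product
    of at most [N - 1] entries of [z_s] leaves two rows of [s] free; so [u] has
    norm at most 1. Let [B] be the [N]-linear form
    [B(y_1, ..., y_N) = (1/n!) sum_{p, t in S_n} sgn t prod_i y_i(p i, t (p i))].
    It has norm 1, [B(u) = 1], and it is close to its norm only at tuples whose
    entries are all close to multiples of one and the same [p(s, m)], with [m]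
    large. Hence if [v] is in the unit ball and [B(v) = 1], cutting the
    indicators [phi_m] at height [M] maps [v] to a combination
    [sum_s chi_s p(s, M)^{⊗N}] with [chi] independent of [M]. These combinations
    converge to [v]; comparing two values of [M] in one slot forces [chi] to
    change sign under the transpositions of [n] with [r <= N], so
    [chi = sgn / n!] and [v = u]. *)
Require Import Defs.
From HB Require Import structures.
From mathcomp Require Import all_boot all_order all_algebra all_fingroup.
From mathcomp Require Import all_classical all_reals all_analysis.
From mathcomp Require Import ring lra.
Set Implicit Arguments.
Unset Strict Implicit.
Unset Printing Implicit Defensive.
Import Order.TTheory GRing.Theory Num.Theory numFieldNormedType.Exports.
Local Open Scope classical_set_scope.
Local Open Scope ring_scope.

(** * Completion of a seminormed space *)

(** The size n = N + 1 balances two opposite demands. [B] reads one row per slot, and these N rows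
    must determine a permutation, so that each p contributes a single sign or nothing: n <= N + 1.
    The alternating sum must not see m: changing m in one slot alters p(s, m) by a vector that is
    the same for all s, and the other N - 1 slots must leave two rows free: n >= N + 1. The matrix
    units lie in [F] so that p(s, m) splits there into a part free of s and matrix units with
    coefficients depending on s; halving them keeps them away from being norming. The obstacle is
    that v lives in a completion and need not be a finite combination of elementary tensors.
    Concentration is therefore proved with explicit constants for finite combinations of mass close
    to 1, and it reaches v only through the cuts, after which finitely many vectors p(s, M) are
    left. *)

Section Seminorm.
Variables (R : realType) (V : lmodType R).

Record seminorm (p : V -> R) : Prop := Seminorm {
  seminormD : forall x y, p (x + y) <= p x + p y;
  seminormZ : forall a x, p (a *: x) = `|a| * p x }.

Variables (p : V -> R) (hp : seminorm p).

Lemma seminorm0 : p 0 = 0.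
Proof. by rewrite -(scale0r (0 : V)) (seminormZ hp) normr0 mul0r. Qed.

Lemma seminormN x : p (- x) = p x.
Proof. by rewrite -scaleN1r (seminormZ hp) normrN1 mul1r. Qed.

Lemma seminormBC x y : p (x - y) = p (y - x).
Proof. by rewrite -seminormN opprB. Qed.

Lemma seminorm_ge0 x : 0 <= p x.
Proof.
have := seminormD hp x (- x).
by rewrite subrr seminorm0 seminormN; lra.
Qed.

Lemma seminorm_dist x y : `|p x - p y| <= p (x - y).
Proof.
have := seminormD hp (x - y) y; rewrite subrK => h1.
have := seminormD hp (y - x) x; rewrite subrK seminormBC => h2.
by rewrite ler_norml; apply/andP; split; lra.
Qed.

Lemma seminorm_sum (I : Type) (r : seq I) (P : pred I) (F : I -> V) :
  p (\sum_(i <- r | P i) F i) <= \sum_(i <- r | P i) p (F i).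
Proof.
elim/big_ind2: _ => [|x a y b pxa pyb|//]; first by rewrite seminorm0.
by rewrite (le_trans (seminormD hp _ _)) // lerD.
Qed.

End Seminorm.

Section Completion.
Variables (R : realType) (V : lmodType R) (p : V -> R) (hp : seminorm p).

(** The completion consists of the [p]-Cauchy sequences modulo those of limit seminorm 0. Since a
    seminorm suffices, definiteness of the tensor norms never has to be established: null vectors
    disappear in the quotient. *)
Definition cauchy_pred : {pred nat -> V} := fun x =>
  `[< forall e : R, 0 < e ->
      exists K : nat, forall i j, (K <= i)%N -> (K <= j)%N -> p (x i - x j) < e >].

Lemma cauchy_pred_submod_closed : submod_closed cauchy_pred.
Proof.
split.
  apply/asboolP => e e0; exists 0%N => i j _ _.
  by rewrite subrr (seminorm0 hp).
move=> a x y /asboolP cx /asboolP cy; apply/asboolP => e e0.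
have d0 : 0 < e / 2 / (`|a| + 1) by rewrite !divr_gt0 // ltr_wpDl.
have [K1 h1] := cx _ d0; have [K2 h2] := cy _ (divr_gt0 e0 (ltr0n R 2)).
exists (maxn K1 K2) => i j; rewrite !geq_max => /andP[i1 i2] /andP[j1 j2].
rewrite opprD addrACA -scalerBr (le_lt_trans (seminormD hp _ _)) //.
rewrite (seminormZ hp) [ltRHS](splitr e) ler_ltD ?h2 //.
have := h1 i j i1 j1; rewrite ltr_pdivlMr ?ltr_wpDl // => /ltW; apply: le_trans.
by rewrite mulrC ler_wpM2l ?(seminorm_ge0 hp) // lerDl.
Qed.

HB.instance Definition _ :=
  GRing.isSubmodClosed.Build R (nat -> V) cauchy_pred cauchy_pred_submod_closed.

Record cauchy_seq := CauchySeq {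
  cauchy_val : nat -> V; cauchy_valP : cauchy_val \in cauchy_pred }.

HB.instance Definition _ := [isSub for cauchy_val].
HB.instance Definition _ := [Choice of cauchy_seq by <:].
HB.instance Definition _ := [SubChoice_isSubLmodule of cauchy_seq by <:].

Lemma cauchy_seqP (x : cauchy_seq) (e : R) : 0 < e ->
  exists K : nat, forall i j, (K <= i)%N -> (K <= j)%N ->
    p (val x i - val x j) < e.
Proof. by move=> e0; have /asboolP := cauchy_valP x; exact. Qed.

Definition seq_norm (x : cauchy_seq) : R := limn (p \o val x).

Lemma cvg_seq_norm (x : cauchy_seq) : p \o val x @ \oo --> seq_norm x.
Proof.
apply/cauchy_cvgP/cauchy_exP => e e0.
have [K hK] := cauchy_seqP x e0.
exists (p (val x K)); exists K => // i /= Ki.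
rewrite /ball /= (le_lt_trans (seminorm_dist hp _ _)) //.
exact: hK.
Qed.

Lemma seq_normP (x : cauchy_seq) (a : R) :
  p \o val x @ \oo --> a -> seq_norm x = a.
Proof. exact: cvg_lim. Qed.

Lemma seq_norm_eq (x y : cauchy_seq) :
  seq_norm (x - y) = 0 -> seq_norm x = seq_norm y.
Proof.
move=> xy0; apply: seq_normP.
have := @cvg_seq_norm (x - y); rewrite xy0 => xy.
rewrite -[seq_norm y]addr0 -[X in X @ _](subrK (p \o val y)) addrC.
apply: cvgD; first exact: cvg_seq_norm.
apply/norm_cvg0P; apply: squeeze_cvgr (cvg_cst 0) xy.
by apply: nearW => n; rewrite normr_ge0 /= (seminorm_dist hp).
Qed.

Lemma seq_normD (x y : cauchy_seq) :
  seq_norm (x + y) <= seq_norm x + seq_norm y.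
Proof.
apply: ler_cvg_to (@cvg_seq_norm (x + y)) (cvgD (@cvg_seq_norm x) (@cvg_seq_norm y)) _.
by apply: nearW => n; exact: (seminormD hp).
Qed.

Lemma seq_normZ a (x : cauchy_seq) : seq_norm (a *: x) = `|a| * seq_norm x.
Proof.
apply: seq_normP; rewrite (_ : p \o _ = (fun n => `|a| * p (val x n))).
  by apply: cvgM; [exact: cvg_cst|exact: (@cvg_seq_norm x)].
by apply/funext => n /=; rewrite (seminormZ hp).
Qed.

Lemma seq_norm0 : seq_norm 0 = 0.
Proof. by rewrite -(scale0r (0 : cauchy_seq)) seq_normZ normr0 mul0r. Qed.

Lemma seq_norm_ge0 (x : cauchy_seq) : 0 <= seq_norm x.
Proof.
apply: ler_cvg_to (cvg_cst 0) (@cvg_seq_norm x) _.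
by apply: nearW => n; exact: (seminorm_ge0 hp).
Qed.

Definition null_seq : {pred cauchy_seq} := fun x => seq_norm x == 0.

Lemma null_seq_submod_closed : submod_closed null_seq.
Proof.
split; first by rewrite -topredE /= /null_seq seq_norm0.
move=> a x y; rewrite -!topredE /= /null_seq => /eqP x0 /eqP y0.
rewrite eq_le seq_norm_ge0 andbT (le_trans (seq_normD _ _)) //.
by rewrite seq_normZ x0 y0 mulr0 addr0.
Qed.

HB.instance Definition _ :=
  GRing.isSubmodClosed.Build R cauchy_seq null_seq null_seq_submod_closed.

Definition completion := Quotient.quot (null_seq : zmodClosed cauchy_seq).

HB.instance Definition _ := GRing.Zmodule.on completion.

Definition class_of (x : cauchy_seq) : completion := \pi_completion%qT x.

Lemma class_ofD x y : class_of (x + y) = class_of x + class_of y.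
Proof. by rewrite /class_of raddfD. Qed.

Lemma class_ofB x y : class_of (x - y) = class_of x - class_of y.
Proof. by rewrite /class_of raddfB. Qed.

Definition class_rep (t : completion) : cauchy_seq := generic_quotient.repr t.

Lemma class_of_rep t : class_of (class_rep t) = t.
Proof. exact: reprK. Qed.

Lemma class_of_eq x y : (class_of x = class_of y) <-> (seq_norm (x - y) = 0).
Proof.
split=> [/eqP|h]; last by apply/eqP; rewrite -Quotient.idealrBE; apply/eqP.
by rewrite -Quotient.idealrBE => /eqP.
Qed.

Definition completion_scale (a : R) (t : completion) : completion :=
  class_of (a *: class_rep t).

Lemma class_ofZ a x : class_of (a *: x) = completion_scale a (class_of x).
Proof.
apply/class_of_eq; rewrite -scalerBr seq_normZ.
by have /class_of_eq -> : class_of x = class_of (class_rep (class_of x));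
  rewrite ?mulr0 // class_of_rep.
Qed.

Lemma completion_scaleA a b t :
  completion_scale a (completion_scale b t) = completion_scale (a * b) t.
Proof. by rewrite -[t]class_of_rep -!class_ofZ scalerA. Qed.

Lemma completion_scale1 : left_id 1 completion_scale.
Proof. by move=> t; rewrite -[t]class_of_rep -!class_ofZ scale1r. Qed.

Lemma completion_scaleDr : right_distributive completion_scale +%R.
Proof.
move=> a t u; rewrite -[t]class_of_rep -[u]class_of_rep.
by rewrite -class_ofD -!class_ofZ scalerDr class_ofD.
Qed.

Lemma completion_scaleDl t : {morph completion_scale^~ t : a b / a + b}.
Proof.
by move=> a b; rewrite -[t]class_of_rep -!class_ofZ scalerDl class_ofD.
Qed.

HB.instance Definition _ := GRing.Zmodule_isLmodule.Build R completion
  completion_scaleA completion_scale1 completion_scaleDr completion_scaleDl.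

Definition completion_norm (t : completion) : R := seq_norm (class_rep t).

Lemma completion_norm_class x : completion_norm (class_of x) = seq_norm x.
Proof. by apply: seq_norm_eq; apply/class_of_eq; rewrite class_of_rep. Qed.

Lemma completion_normD t u :
  completion_norm (t + u) <= completion_norm t + completion_norm u.
Proof.
rewrite -[t]class_of_rep -[u]class_of_rep -class_ofD !completion_norm_class.
exact: seq_normD.
Qed.

Lemma completion_normZ a t : completion_norm (a *: t) = `|a| * completion_norm t.
Proof. by rewrite completion_norm_class seq_normZ. Qed.

Lemma completion_norm_eq0 t : completion_norm t = 0 -> t = 0.
Proof.
rewrite -[t]class_of_rep completion_norm_class => t0.
have -> : 0 = class_of 0 by rewrite /class_of raddf0.
by apply/class_of_eq; rewrite subr0.
Qed.

HB.instance Definition _ := Lmodule_isNormed.Build R completion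
  completion_normD completion_normZ completion_norm_eq0.

Lemma normr_class_of x : `|class_of x| = seq_norm x.
Proof. exact: completion_norm_class. Qed.

Lemma const_cauchy (v : V) : (fun=> v) \in cauchy_pred.
Proof.
by apply/asboolP => e e0; exists 0%N => i j _ _; rewrite subrr (seminorm0 hp).
Qed.

Definition to_completion (v : V) : completion :=
  class_of (CauchySeq (const_cauchy v)).

Lemma to_completion_linear : linear to_completion.
Proof.
move=> a u v.
have -> : a *: to_completion u = class_of (a *: CauchySeq (const_cauchy u)).
  by rewrite class_ofZ.
by rewrite -class_ofD; congr class_of; apply: val_inj.
Qed.

HB.instance Definition _ :=
  GRing.isLinear.Build R V completion _ to_completion to_completion_linear.

Lemma normr_to_completion v : `|to_completion v| = p v.
Proof. by rewrite normr_class_of; apply: seq_normP; exact: (@cvg_cst _ (p v)). Qed.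

Lemma class_of_approx (x : cauchy_seq) (e : R) (K : nat) :
  (forall i, (K <= i)%N -> p (val x i - val x K) <= e) ->
  `|class_of x - to_completion (val x K)| <= e.
Proof.
move=> h; rewrite -class_ofB normr_class_of.
apply: ler_cvg_to (@cvg_seq_norm _) (cvg_cst e) _.
by exists K => // i Ki; exact: h.
Qed.

Lemma completion_dense (t : completion) (e : R) : 0 < e ->
  exists v, `|t - to_completion v| < e.
Proof.
move=> e0; have [K hK] := cauchy_seqP (class_rep t) (divr_gt0 e0 (ltr0n R 2)).
exists (val (class_rep t) K).
rewrite -{1}[t]class_of_rep (@le_lt_trans _ _ (e / 2)) //; last lra.
by apply: class_of_approx => i Ki; rewrite ltW ?hK.
Qed.

Lemma completion_complete (G : set_system completion) :
  ProperFilter G -> cauchy G -> cvg G.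
Proof.
move=> PG /cauchyP cG.
have [u u_gt0 small] : exists2 u : nat -> R, forall k, 0 < u k &
    forall e, 0 < e -> exists K : nat, forall k, (K <= k)%N -> u k < e.
  exists (fun k => k.+1%:R^-1) => [k|e e0]; first by rewrite invr_gt0 ltr0n.
  have [K _ hK] := near_infty_natSinv_lt (PosNum e0).
  by exists K => k Kk; exact: hK.
have /choice[v hv] : forall k : nat, exists v : V, G (ball (to_completion v) (u k)).
  move=> k; have uk0 := divr_gt0 (u_gt0 k) (ltr0n R 2).
  have [t Gt] := cG _ uk0; have [v tv] := completion_dense t uk0.
  exists v; apply: filterS Gt => s; rewrite -!ball_normE /= => ts.
  rewrite (le_lt_trans (ler_distD t _ _)) // [ltRHS]splitr.
  by rewrite ltrD // distrC.
have vv k l : p (v k - v l) < u k + u l.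
  have [s [ks ls]] := filter_ex (filterI (hv k) (hv l)).
  rewrite -normr_to_completion raddfB (le_lt_trans (ler_distD s _ _)) //.
  by move: ks ls; rewrite -!ball_normE /= => ks ls; rewrite ltrD // distrC.
have vc : v \in cauchy_pred.
  apply/asboolP => e e0; have [K hK] := small _ (divr_gt0 e0 (ltr0n R 2)).
  exists K => i j Ki Kj; rewrite (lt_trans (vv _ _)) // [ltRHS]splitr.
  by rewrite ltrD ?hK.
apply/cvg_ex; exists (class_of (CauchySeq vc)); apply/cvg_ballP => e e0.
have [K hK] := small _ (divr_gt0 e0 (ltr0n R 4)).
near \oo => k.
apply: filterS (hv K) => s; rewrite -!ball_normE /= => Ks.
rewrite (le_lt_trans (ler_distD (to_completion (v K)) _ _)) //.
have := @class_of_approx (CauchySeq vc) (e / 2) K _.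
have := hK K (leqnn _).
suff h i : (K <= i)%N -> p (v i - v K) <= e / 2 by move=> ? /(_ h); lra.
by move=> Ki; have := vv i K; have := hK K (leqnn _); have := hK i Ki; lra.
Unshelve. all: end_near. Qed.

HB.instance Definition _ :=
  Uniform_isComplete.Build completion completion_complete.

Lemma completion_exists : exists (T : completeNormedModType R)
  (iota : {linear V -> T}), is_completion p iota.
Proof.
exists completion, to_completion; split; first exact: normr_to_completion.
move=> O [t Ot] oO.
have /nbhs_ballP[e /= e0 eO] : nbhs t O by exact: open_nbhs_nbhs.
have [v tv] := completion_dense t e0.
by exists (to_completion v); split; [apply: eO; rewrite -ball_normE|exists v].
Qed.

End Completion.

(** * Extension of bounded maps and atomic gauges *)

Section Extension.
Variables (R : realType) (V : lmodType R) (p : V -> R).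
Variables (T : completeNormedModType R) (iota : {linear V -> T}).
Hypothesis iotaP : is_completion p iota.

Lemma completion_approx (t : T) (e : R) : 0 < e ->
  exists v, `|t - iota v| < e.
Proof.
move=> e0; have /(_ (ball t e)) := iotaP.2.
case; first by exists t; exact: ballxx.
  exact: ball_open.
by move=> x [tx [v _ vx]]; exists v; move: tx; rewrite -vx -ball_normE.
Qed.

Lemma completion_ext (E : normedModType R) (f g : {linear T -> E}) (C : R) :
    (forall t, `|f t| <= C * `|t|) -> (forall t, `|g t| <= C * `|t|) ->
  (forall v, f (iota v) = g (iota v)) -> forall t, f t = g t.
Proof.
move=> fC gC fg t; apply/eqP; rewrite -subr_eq0 -normr_le0.
apply/ler_addgt0Pr => e e0; rewrite add0r.
have d0 : 0 < e / 2 / (`|C| + 1) by rewrite !divr_gt0 // ltr_wpDl.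
have [v tv] := completion_approx t d0.
have -> : f t - g t = f (t - iota v) - g (t - iota v).
  by rewrite !linearB /= fg opprK [- g t + _]addrC addrA subrK.
rewrite (le_trans (ler_normB _ _)) // [leRHS]splitr.
have bound : C * `|t - iota v| <= e / 2.
  rewrite (@le_trans _ _ (`|C| * `|t - iota v|)) ?ler_wpM2r ?ler_norm //.
  have := ltW tv; rewrite ler_pdivlMr ?ltr_wpDl //; apply: le_trans.
  by rewrite mulrC ler_wpM2l // lerDl.
by rewrite lerD // (le_trans _ bound).
Qed.

Variables (E : completeNormedModType R) (L : {linear V -> E}) (C : R).
Hypotheses (C0 : 0 <= C) (LC : forall v, `|L v| <= C * p v).

(** The value at t is pinned down by |f t - L v| <= C |t - iota v| for all v. This estimate gives
    uniqueness, hence linearity, and for v = 0 the norm bound. *)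
Lemma completion_extend : exists f : {linear T -> E},
  (forall v, f (iota v) = L v) /\ (forall t, `|f t| <= C * `|t|).
Proof.
have Lap u v : `|L u - L v| <= C * `|iota u - iota v|.
  by have := LC (u - v); rewrite -iotaP.1 !linearB.
have /choice[f fP] (t : T) : exists e : E, forall v, `|e - L v| <= C * `|t - iota v|.
  (* The sets containing [L v] for all v with [iota v] close enough to t. This filter is Cauchy
     because [L] is Lipschitz, and its limit is the value sought. *)
  pose G : set_system E := [set A | exists2 d : R, 0 < d &
    forall v, `|t - iota v| < d -> A (L v)].
  have FG : Filter G.
    split; first by exists 1.
      move=> A B [d d0 Ad] [d' d'0 Bd]; exists (Num.min d d').
        by rewrite lt_min d0.
      by move=> v; rewrite lt_min => /andP[? ?]; split; [exact: Ad|exact: Bd].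
    by move=> A B AB [d d0 Ad]; exists d => // v /Ad /AB.
  have PG : ProperFilter G.
    by split=> // -[d d0 Ad]; have [v /Ad] := completion_approx t d0.
  have /cauchy_cvgP/cvg_ex[e Ge] : cauchy G.
    apply/cauchy_exP => e e0.
    have d0 : 0 < e / 2 / (C + 1) by rewrite !divr_gt0 // ltr_wpDl.
    have [v tv] := completion_approx t d0.
    exists (L v); exists (e / 2 / (C + 1)) => // w tw.
    rewrite -ball_normE /= (le_lt_trans (Lap _ _)) //.
    have vw : `|iota v - iota w| <= e / (C + 1).
      rewrite (le_trans (ler_distD t _ _)) // [`|iota v - t|]distrC.
      by rewrite (_ : e / _ = e / 2 / (C + 1) + e / 2 / (C + 1)) ?lerD ?ltW //
         -mulrDl -splitr.
    rewrite (le_lt_trans (ler_wpM2l C0 vw)) // mulrCA -[ltRHS]mulr1.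
    by rewrite ltr_pM2l // ltr_pdivrMr ?ltr_wpDl // mul1r ltrDl.
  exists e => v; apply/ler_addgt0Pr => n n0.
  have d0 : 0 < n / 2 / (C + 1) by rewrite !divr_gt0 // ltr_wpDl.
  have [d d1 ed] := Ge _ (nbhsx_ballx e _ (divr_gt0 n0 (ltr0n R 2))).
  have m0 : 0 < Num.min d (n / 2 / (C + 1)) by rewrite lt_min d1.
  have [w] := completion_approx t m0.
  rewrite lt_min => /andP[/ed + tw]; rewrite -ball_normE /= => eLw.
  have h1 := ler_distD (L w) e (L v); have h2 := Lap w v.
  have h3 : C * `|iota w - iota v| <= C * (`|t - iota w| + `|t - iota v|).
    by rewrite ler_wpM2l // [`|t - iota w|]distrC ler_distD.
  have h4 : C * `|t - iota w| <= n / 2.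
    move: (ltW tw); rewrite ler_pdivlMr ?ltr_wpDl //.
    by apply: le_trans; rewrite mulrC ler_wpM2l // lerDl.
  by move: h3; rewrite mulrDr; lra.
have f_uniq t e : (forall d, 0 < d -> exists2 v, `|t - iota v| < d & `|e - L v| < d) ->
    f t = e.
  move=> h; apply/eqP; rewrite -subr_eq0 -normr_le0.
  apply/ler_addgt0Pr => n n0; rewrite add0r.
  have d0 : 0 < n / (C + 1) by rewrite divr_gt0 // ltr_wpDl.
  have [v tv ev] := h _ d0.
  rewrite (le_trans (ler_distD (L v) _ _)) //.
  rewrite (_ : n = C * (n / (C + 1)) + n / (C + 1)); last first.
    by field; rewrite gt_eqF // ltr_wpDl.
  apply: lerD; last by rewrite distrC ltW.
  by rewrite (le_trans (fP _ _)) // ler_wpM2l // ltW.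
have fL v : f (iota v) = L v.
  by apply: f_uniq => d d0; exists v; rewrite subrr normr0.
have fl : linear f.
  move=> a t u; apply: f_uniq => d d0.
  have b0 : 0 < `|a| + 1 + C * (`|a| + 1) + 1.
    by rewrite ltr_wpDl ?addr_ge0 ?mulr_ge0 ?addr_ge0.
  have e0 := divr_gt0 d0 b0.
  have [v tv] := completion_approx t e0; have [w uw] := completion_approx u e0.
  have bd x y : x < d / (`|a| + 1 + C * (`|a| + 1) + 1) ->
      y < d / (`|a| + 1 + C * (`|a| + 1) + 1) -> 
      `|a| * x + y < d /\ `|a| * (C * x) + C * y < d.
    set e1 := d / _ in e0 *; move=> xe ye.
    have de : d = e1 * (`|a| + 1 + C * (`|a| + 1) + 1).
      by rewrite /e1 mulfVK // gt_eqF.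
    have a0 := normr_ge0 a; have e10 : 0 <= e1 := ltW e0.
    have h1 : `|a| * x <= `|a| * e1 by rewrite ler_wpM2l // ltW.
    have h2 : C * (`|a| * x) <= C * (`|a| * e1) by rewrite ler_wpM2l.
    have h3 : C * y <= C * e1 by rewrite ler_wpM2l // ltW.
    have h4 : 0 <= C * (`|a| * e1) by rewrite mulr_ge0 // mulr_ge0.
    have h5 : 0 <= C * e1 by rewrite mulr_ge0.
    have h6 : 0 <= `|a| * e1 by rewrite mulr_ge0.
    by split; nra.
  have [h1 h2] := bd _ _ tv uw.
  exists (a *: v + w).
    rewrite linearP opprD addrACA -scalerBr.
    by rewrite (le_lt_trans (ler_normD _ _)) // normrZ.
  rewrite linearP opprD addrACA -scalerBr.
  rewrite (le_lt_trans (ler_normD _ _)) // normrZ (le_lt_trans _ h2) //.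
  by rewrite lerD // ler_wpM2l.
pose fE := HB.pack_for {linear T -> E} f (GRing.isLinear.Build R T E _ f fl).
exists fE; split=> // t /=.
by have := fP t 0; rewrite !linear0 !addr0.
Qed.

End Extension.

Lemma lipschitz_linear_continuous (R : realType) (E F : normedModType R)
    (f : {linear E -> F}) (C : R) :
  (forall t, `|f t| <= C * `|t|) -> continuous f.
Proof.
move=> fC; apply/bounded_linear_continuous/bounded_funP => r.
exists (`|C| * r) => x xr; rewrite (le_trans (fC x)) //.
by rewrite (le_trans (ler_wpM2r _ (ler_norm C))) // ler_wpM2l.
Qed.

Section Gauge.
Variables (R : realType) (V : lmodType R) (I : Type) (a : I -> V) (rho : I -> R).
Hypothesis rho_ge0 : forall i, 0 <= rho i.
Hypothesis gen : forall v, exists (n : nat) (c : 'I_n -> R) (i : 'I_n -> I),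
  v = \sum_(j < n) c j *: a (i j).

Definition atomic (l : seq (R * I)) : V := \sum_(x <- l) x.1 *: a x.2.
Definition mass (l : seq (R * I)) : R := \sum_(x <- l) `|x.1| * rho x.2.

(** For positive [rho], the Minkowski functional of the absolutely convex hull of the [a i / rho i].
    The norm of [F] and both tensor norms have this form. The indexing by ordinals copies
    [sym_proj_norm]; proofs use the list form of [gaugeE], where adding representations is
    concatenation. *)
Definition gauge (v : V) : R :=
  inf [set s | exists (n : nat) (c : 'I_n -> R) (i : 'I_n -> I),
         v = \sum_(j < n) c j *: a (i j) /\
         s = \sum_(j < n) `|c j| * rho (i j)].

Lemma gaugeE v : gauge v = inf [set s | exists2 l, v = atomic l & s = mass l].
Proof.
congr inf; apply/seteqP; split=> s.
  move=> [n [c [i [-> ->]]]]; exists [seq (c j, i j) | j <- enum 'I_n].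
    by rewrite /atomic big_map big_enum.
  by rewrite /mass big_map big_enum.
move=> [l -> ->]; exists (size l), (fun j => (tnth (in_tuple l) j).1),
  (fun j => (tnth (in_tuple l) j).2).
by split; [rewrite /atomic big_tnth|rewrite /mass big_tnth].
Qed.

Lemma mass_ge0 l : 0 <= mass l.
Proof. by apply: sumr_ge0 => x _; rewrite mulr_ge0. Qed.

Lemma atomic_surj v : exists l, v = atomic l.
Proof.
have [n [c [i ->]]] := gen v; exists [seq (c j, i j) | j <- enum 'I_n].
by rewrite /atomic big_map big_enum.
Qed.

Let masses v := [set s | exists2 l, v = atomic l & s = mass l].

Let masses_has_inf v : has_inf (masses v).
Proof.
split; first by have [l vl] := atomic_surj v; exists (mass l), l.
by exists 0 => _ [l _ ->]; exact: mass_ge0.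
Qed.

Lemma gauge_le_mass l : gauge (atomic l) <= mass l.
Proof.
by rewrite gaugeE; apply: ge_inf; [exact: (masses_has_inf _).2|exists l].
Qed.

Lemma gauge_ge0 v : 0 <= gauge v.
Proof.
rewrite gaugeE; apply: lb_le_inf; first exact: (masses_has_inf v).1.
by move=> _ [l _ ->]; exact: mass_ge0.
Qed.

Lemma gauge_approx v e : 0 < e -> exists2 l, v = atomic l & mass l < gauge v + e.
Proof.
move=> e0; have [_ [l vl ->]] := inf_adherent e0 (masses_has_inf v).
by rewrite -gaugeE => h; exists l.
Qed.

(** [gauge] is the largest seminorm bounded by [rho] on the atoms, so bounds on linear maps are
    checked on atoms alone. *)
Lemma gauge_bound (q : V -> R) (C : R) : seminorm q -> 0 <= C ->
  (forall i, q (a i) <= C * rho i) -> forall v, q v <= C * gauge v.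
Proof.
move=> hq C0 qa v; apply/ler_addgt0Pr => e e0.
have d0 : 0 < e / (C + 1) by rewrite divr_gt0 // ltr_wpDl.
have [l -> lv] := gauge_approx v d0.
apply: (@le_trans _ _ (C * mass l)).
  rewrite (le_trans (seminorm_sum hq _ _ _)) // mulr_sumr ler_sum // => x _.
  by rewrite (seminormZ hq) mulrCA ler_wpM2l.
rewrite (le_trans (ler_wpM2l C0 (ltW lv))) // mulrDr lerD2l mulrCA.
rewrite -[leRHS]mulr1 ler_pM2l // ler_pdivrMr ?ltr_wpDl // mul1r lerDl //.
Qed.

Lemma atomic_cat l m : atomic (l ++ m) = atomic l + atomic m.
Proof. by rewrite /atomic big_cat. Qed.

Lemma mass_cat l m : mass (l ++ m) = mass l + mass m.
Proof. by rewrite /mass big_cat. Qed.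

Lemma gauge_seminorm : seminorm gauge.
Proof.
have scale_le c v : gauge (c *: v) <= `|c| * gauge v.
  apply/ler_addgt0Pr => e e0.
  have d0 : 0 < e / (`|c| + 1) by rewrite divr_gt0 // ltr_wpDl.
  have [l -> lv] := gauge_approx v d0.
  have -> : c *: atomic l = atomic [seq (c * x.1, x.2) | x <- l].
    rewrite /atomic big_map scaler_sumr; apply: eq_bigr => x _.
    by rewrite scalerA.
  rewrite (le_trans (gauge_le_mass _)) //.
  have -> : mass [seq (c * x.1, x.2) | x <- l] = `|c| * mass l.
    rewrite /mass big_map mulr_sumr; apply: eq_bigr => x _ /=.
    by rewrite normrM mulrA.
  rewrite (le_trans (ler_wpM2l _ (ltW lv))) // mulrDr lerD2l mulrCA.
  rewrite -[leRHS]mulr1 ler_pM2l // ler_pdivrMr ?ltr_wpDl // mul1r lerDl //.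
split=> [v w|c v].
  apply/ler_addgt0Pr => e e0; have d0 := divr_gt0 e0 (ltr0n R 2).
  have [l vE vl] := gauge_approx v d0; have [m wE wm] := gauge_approx w d0.
  rewrite {1}vE {1}wE -atomic_cat (le_trans (gauge_le_mass _)) // mass_cat.
  by lra.
apply/eqP; rewrite eq_le scale_le /=.
have [->|c0] := eqVneq c 0; first by rewrite normr0 mul0r gauge_ge0.
rewrite -ler_pdivlMl ?normr_gt0 // -normfV.
by rewrite -[leLHS](congr1 gauge (scalerK c0 v)) scale_le.
Qed.

Lemma gauge_atom i : gauge (a i) <= rho i.
Proof.
have := gauge_le_mass [:: (1, i)].
by rewrite /atomic /mass !big_seq1 /= scale1r normr1 mul1r.
Qed.

End Gauge.

(** * Norming tuples of permutations *)

(** Injectivity leaves a single value for the omitted point. On N + 1 points this says that the N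
    rows read by the slots determine the permutation. *)
Lemma perm_eq_off1 (T : finType) (l : T) (s t : {perm T}) :
  (forall x, x != l -> s x = t x) -> s = t.
Proof.
move=> st; apply/permP => x; have [->|/st//] := eqVneq x l.
have [y ty] : exists y, t y = s l by exists ((t^-1)%g (s l)); rewrite permKV.
have [yl|yl] := eqVneq y l; first by rewrite -ty yl.
by move: (st _ yl) (yl); rewrite ty => /perm_inj ->; rewrite eqxx.
Qed.

(** The quotient of s by t is even and moves at most a, b and l, so it is trivial or a 3-cycle; but
    each of the two 3-cycles maps a to b or b to a, which the last two hypotheses exclude. *)
Lemma even_perm_off3 (T : finType) (a b l : T) (s t : {perm T}) :
    a != b -> l != a -> l != b -> (forall x, x != a -> x != b -> x != l -> s x = t x) ->
    odd_perm s = odd_perm t -> s a <> t b -> s b <> t a -> s a = t a.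
Proof.
move=> ab la lb st so sab sba; pose r := (s * t^-1)%g.
have rE x : t (r x) = s x by rewrite permM permKV.
have ro : odd_perm r = false by rewrite odd_permM odd_permV so addbb.
have rfix x : x != a -> x != b -> x != l -> r x = x.
  by move=> xa xb xl; apply: (@perm_inj _ t); rewrite rE st.
have rin x y : r x = y -> x != y -> y \in [:: a; b; l].
  move=> rxy xy; rewrite !inE; apply: contraT; rewrite !negb_or.
  case/and3P=> /rfix h /h{}h /h ry; move: xy.
  by rewrite -(inj_eq (@perm_inj _ r)) rxy ry eqxx.
have rab : r a != b by apply/eqP => h; apply: sab; rewrite -rE h.
have rba : r b != a by apply/eqP => h; apply: sba; rewrite -rE h.
have [raa|raa] := eqVneq (r a) a; first by rewrite -rE raa.
have ral : r a = l.
  have := rin a _ erefl; rewrite eq_sym => /(_ raa).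
  by rewrite !inE (negbTE raa) (negbTE rab) => /eqP.
have rbb : r b = b.
  apply/eqP; apply: contraT => rbb.
  have := rin b _ erefl; rewrite eq_sym => /(_ rbb).
  rewrite !inE (negbTE rba) (negbTE rbb) /= -ral => /eqP/perm_inj/eqP.
  by rewrite eq_sym (negbTE ab).
have rE' : r = tperm a l.
  apply: (@perm_eq_off1 _ l) => x xl; have [->|xa] := eqVneq x a.
    by rewrite tpermL.
  rewrite tpermD // 1?eq_sym //; have [->//|xb] := eqVneq x b.
  exact: rfix.
by move: ro; rewrite rE' odd_tperm eq_sym la.
Qed.

Section Combinatorics.
Variable (N : nat).
Hypothesis N2 : (2 <= N)%N.

(** Slot i will read row [p (wid i)]; the row [p ord_max] stays unread. *)
Definition wid : 'I_N -> 'I_N.+1 := widen_ord (leqnSn N).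

Lemma wid_inj : injective wid.
Proof. by move=> i j /(congr1 val) /= ij; apply: val_inj. Qed.

Lemma wid_max i : wid i != ord_max.
Proof. by rewrite -val_eqE /= neq_ltn ltn_ord. Qed.

Lemma widP x : x != ord_max -> exists i, x = wid i.
Proof.
move=> xm; have xN : (x < N)%N.
  by rewrite ltn_neqAle -ltnS ltn_ord andbT; apply: contra_neq xm => xN; apply: val_inj.
by exists (Ordinal xN); apply: val_inj.
Qed.

(** Indices of the atoms of [F]: [inl (s, m)] stands for p(s, m), [inr (a, b)] for a matrix unit.
    [entry] sees only the matrix part, hence not m. *)
Definition idx := ('S_N.+1 * nat + 'I_N.+1 * 'I_N.+1)%type.

Definition entry (k : idx) (i j : 'I_N.+1) : bool :=
  match k with inl (s, _) => s i == j | inr (a, b) => (a == i) && (b == j) end.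

Lemma entry_uniq k i j j' : entry k i j -> entry k i j' -> j = j'.
Proof.
case: k => [[s m]|[a b]] /=; first by move=> /eqP <- /eqP.
by move=> /andP[_ /eqP <-] /andP[_ /eqP].
Qed.

Definition hit (k : 'I_N -> idx) (p t : 'S_N.+1) : bool :=
  [forall i, entry (k i) (p (wid i)) (t (p (wid i)))].

Lemma hit_uniq k p t t' : hit k p t -> hit k p t' -> t = t'.
Proof.
move=> /forallP h /forallP h'; apply: (@perm_eq_off1 _ (p ord_max)) => x xp.
have [i ix] : exists i, (p^-1)%g x = wid i.
  by apply: widP; apply: contra_neq xp => <-; rewrite permKV.
by have -> : x = p (wid i); [rewrite -ix permKV|exact: entry_uniq (h i) (h' i)].
Qed.

(** To compare s i and s j at row a, let slot i read row a, then let slots i and j exchange their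
    rows. The two permutations hit have the same sign and agree except on these two rows and the
    unread one. Since s i and s j take distinct values on distinct rows, [even_perm_off3]
    applies. *)
Lemma hit_const (s : 'I_N -> 'S_N.+1) (m : 'I_N -> nat) (b : bool) :
    (forall p, exists2 t, hit (fun i => inl (s i, m i)) p t & odd_perm t = b) ->
  forall i j, s i = s j.
Proof.
move=> h i j; have [->//|ij] := eqVneq i j; apply/permP => a.
pose p := tperm (wid i) a; pose p' := (tperm (wid i) (wid j) * p)%g.
have [t /forallP /= ht tb] := h p; have [t' /forallP /= ht' tb'] := h p'.
have pi : p (wid i) = a by rewrite tpermL.
have pi' : p' (wid i) = p (wid j) by rewrite permM tpermL.
have pj' : p' (wid j) = a by rewrite permM tpermR pi.
have ta : t a = s i a by have := ht i; rewrite pi => /eqP.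
have tpj : t (p (wid j)) = s j (p (wid j)) by have /eqP := ht j.
have ta' : t' a = s j a by have := ht' j; rewrite pj' => /eqP.
have tpj' : t' (p (wid j)) = s i (p (wid j)) by have := ht' i; rewrite pi' => /eqP.
have apj : a != p (wid j) by rewrite -pi (inj_eq perm_inj) (inj_eq wid_inj).
have la : p ord_max != a by rewrite -pi (inj_eq perm_inj) eq_sym wid_max.
have lj : p ord_max != p (wid j) by rewrite (inj_eq perm_inj) eq_sym wid_max.
rewrite -ta -ta'; apply: (@even_perm_off3 _ a (p (wid j)) (p ord_max)) => //.
- move=> x xa xj xl; have [k kx] : exists k, (p^-1)%g x = wid k.
    by apply: widP; apply: contra_neq xl => <-; rewrite permKV.
  have {}kx : x = p (wid k) by rewrite -kx permKV.
  have pk' : p' (wid k) = x.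
    rewrite permM tpermD ?kx // (inj_eq wid_inj).
      by apply: contra_neq xa => ik; rewrite kx -ik pi.
    by apply: contra_neq xj => jk; rewrite kx jk.
  by have /eqP := ht k; rewrite -kx => <-; have /eqP := ht' k; rewrite pk' => <-.
- by rewrite tb tb'.
- by rewrite ta tpj'; apply/eqP; rewrite (inj_eq perm_inj).
- by rewrite tpj ta'; apply/eqP; rewrite (inj_eq perm_inj) eq_sym.
Qed.

(** * The normalized alternating form and its values on tuples of atoms *)

Variable R : realType.

Local Notation K := (#|{: 'S_N.+1}|%:R : R).

Lemma K_gt0 : 0 < K.
Proof. by rewrite ltr0n; apply/card_gt0P; exists 1%g. Qed.

Definition altform (y : 'I_N -> 'I_N.+1 -> 'I_N.+1 -> R) : R :=
  K^-1 * \sum_(p : 'S_N.+1) \sum_(t : 'S_N.+1)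
    (-1) ^+ t * \prod_(i < N) y i (p (wid i)) (t (p (wid i))).

Lemma prodr_dist_le (I : Type) (r : seq I) (a b : I -> R) :
    (forall i, `|a i| <= 1) -> (forall i, `|b i| <= 1) ->
  `|\prod_(i <- r) a i - \prod_(i <- r) b i| <= \sum_(i <- r) `|a i - b i|.
Proof.
move=> a1 b1; elim: r => [|i r IH]; first by rewrite !big_nil subrr normr0.
rewrite !big_cons -(subrK (a i * \prod_(j <- r) b j) (a i * _)) -mulrBr -addrA -mulrBl.
rewrite (le_trans (ler_normD _ _)) // addrC !normrM lerD //.
  rewrite ler_piMr // normr_prod; apply: (@prodr_ile1 _ _ _ xpredT) => j _.
  by rewrite normr_ge0 b1.
by rewrite (le_trans _ IH) // ler_piMl.
Qed.

Lemma altform_lipschitz (y z : 'I_N -> 'I_N.+1 -> 'I_N.+1 -> R) d :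
    (forall i a b, `|y i a b| <= 1) -> (forall i a b, `|z i a b| <= 1) ->
    (forall i a b, `|y i a b - z i a b| <= d) ->
  `|altform y - altform z| <= K * N%:R * d.
Proof.
move=> y1 z1 yz; rewrite -mulrBr normrM [`|K^-1|]ger0_norm ?invr_ge0 ?ler0n //.
have -> : K * N%:R * d = K^-1 * \sum_(p : 'S_N.+1) \sum_(t : 'S_N.+1) \sum_(i < N) d.
  have h (T : finType) (x : R) : \sum_(i : T) x = #|T|%:R * x.
    by rewrite sumr_const mulr_natl.
  by rewrite !h card_ord mulKf ?mulrA // gt_eqF ?K_gt0.
rewrite ler_wpM2l ?invr_ge0 ?ler0n // -sumrB (le_trans (ler_norm_sum _ _ _)) //.
apply: ler_sum => p _; rewrite -sumrB (le_trans (ler_norm_sum _ _ _)) //.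
apply: ler_sum => t _; rewrite -mulrBr normrM normr_sign mul1r.
by rewrite (le_trans (prodr_dist_le _ _ _)) // ler_sum.
Qed.

Definition altidx (k : 'I_N -> idx) : R :=
  altform (fun i a b => (entry (k i) a b)%:R).

Lemma prod_entry (k : 'I_N -> idx) (p t : 'S_N.+1) :
  \prod_(i < N) (entry (k i) (p (wid i)) (t (p (wid i))))%:R = (hit k p t)%:R :> R.
Proof.
have [/forallP h|/forallPn[i hi]] := boolP (hit k p t).
  by rewrite big1 // => i _; rewrite h.
by rewrite (bigD1 i) //= (negbTE hi) mul0r.
Qed.

(** The share of p in [altidx]: since at most one t is hit, it is a sign or 0. *)
Definition hitsum k p : R := \sum_(t : 'S_N.+1) (-1) ^+ t * (hit k p t)%:R.

Lemma altidxE k : altidx k = K^-1 * \sum_p hitsum k p.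
Proof.
congr (_ * _); apply: eq_bigr => p _; apply: eq_bigr => t _.
by rewrite prod_entry.
Qed.

Lemma hitsum_hit k p t : hit k p t -> hitsum k p = (-1) ^+ t.
Proof.
move=> h; rewrite /hitsum (bigD1 t) //= h mulr1 big1 ?addr0 // => t' t't.
case: (boolP (hit k p t')) => [h'|_]; last by rewrite mulr0.
by rewrite (hit_uniq h h') eqxx in t't.
Qed.

Lemma hitsum_norm k p : `|hitsum k p| <= 1.
Proof.
have [/existsP[t h]|/existsPn h] := boolP [exists t, hit k p t].
  by rewrite (hitsum_hit h) normr_sign.
by rewrite /hitsum big1 ?normr0 // => t _; rewrite (negbTE (h t)) mulr0.
Qed.

Lemma hitsum_sign k p (b : bool) : (-1) ^+ b * hitsum k p <= 0 \/
  exists2 t, hit k p t & odd_perm t = b.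
Proof.
have [/existsP[t h]|/existsPn h] := boolP [exists t, hit k p t]; last first.
  by left; rewrite /hitsum big1 ?mulr0 // => t _; rewrite (negbTE (h t)) mulr0.
rewrite (hitsum_hit h); have [<-|tb] := eqVneq (odd_perm t) b.
  by right; exists t.
left; have -> : odd_perm t = ~~ b by move: tb; case: (odd_perm t); case: (b).
by case: (b); rewrite /= ?expr0 ?expr1; lra.
Qed.

Lemma altidx_norm k : `|altidx k| <= 1.
Proof.
rewrite altidxE normrM [`|K^-1|]ger0_norm ?invr_ge0 ?ler0n // ler_pdivrMl ?K_gt0 // mulr1.
rewrite (le_trans (ler_norm_sum _ _ _)) // -sumr_const ler_sum // => p _.
exact: hitsum_norm.
Qed.

Lemma altidx_const (s : 'S_N.+1) (m : 'I_N -> nat) :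
  altidx (fun i => inl (s, m i)) = (-1) ^+ s.
Proof.
rewrite altidxE (eq_bigr (fun=> (-1) ^+ s)) => [|p _]; last first.
  by rewrite (@hitsum_hit _ _ s) //; apply/forallP => i /=.
by rewrite sumr_const -[X in _ * X]mulr_natl mulKf // gt_eqF ?K_gt0.
Qed.

(** By [hit_const], neither sign can be hit for every p. So for each sign b some p contributes at
    most 0 to (-1)^b times the sum, and the other K - 1 permutations contribute at most 1 each. *)
Lemma altidx_nonconst (s : 'I_N -> 'S_N.+1) (m : 'I_N -> nat) i j :
  s i != s j -> `|altidx (fun i => inl (s i, m i))| <= 1 - K^-1.
Proof.
move=> sij; set k := fun i => _.
have half (b : bool) : (-1) ^+ b * altidx k <= 1 - K^-1.
  have [p hp] : exists p, (-1) ^+ b * hitsum k p <= 0.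
    apply/not_existsP => h; move/eqP: sij; apply; apply: (@hit_const s m b) => p.
    by case: (hitsum_sign k p b) => // /h.
  rewrite altidxE mulrCA ler_pdivrMl ?K_gt0 // mulrBr mulr1 divff ?gt_eqF ?K_gt0 //.
  rewrite mulr_sumr (bigD1 p) //=.
  have : \sum_(q | q != p) (-1) ^+ b * hitsum k q <= \sum_(q : 'S_N.+1 | q != p) 1.
    apply: ler_sum => q _; rewrite (le_trans (ler_norm _)) // normrM normr_sign mul1r.
    exact: hitsum_norm.
  have : K = 1 + \sum_(q : 'S_N.+1 | q != p) 1 by rewrite -sumr_const (bigD1 p).
  by lra.
rewrite ler_norml; have := half false; have := half true.
by rewrite expr0 expr1; lra.
Qed.

(* The weight of [p(s, m)] exceeds 1, so that [B] never attains its norm, but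
   tends to 1. *)
Definition wt (k : idx) : R :=
  match k with inl (_, m) => 1 + m.+1%:R^-1 | inr _ => 2 end.

Lemma wt_ge1 k : 1 <= wt k.
Proof. by case: k => [[s m]|[a b]] /=; rewrite ?lerDl ?invr_ge0 // ler1n. Qed.

Lemma wt_ge0 k : 0 <= wt k. Proof. exact: le_trans (wt_ge1 k). Qed.

Lemma wt_le2 k : wt k <= 2.
Proof.
case: k => [[s m]|[a b]] //=.
by rewrite -[leRHS]/(1 + 1) lerD2l invf_le1 ?ltr0n // ler1n.
Qed.

(** One constant below three losses: 1/K for tuples with different permutations, 1 - 1/wt = 1/(m+2)
    for a p(s, m) with m < M, and 1/2 for a matrix unit. *)
Definition gap (M : nat) : R := (K + M.+1%:R)^-1.

Lemma gap_gt0 M : 0 < gap M.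
Proof. by rewrite invr_gt0 addr_gt0 ?K_gt0 ?ltr0n. Qed.

Lemma gap_le M (x : R) : 0 < x -> x <= K \/ x <= M.+1%:R -> gap M <= x^-1.
Proof.
move=> x0 h; rewrite lef_pV2 ?posrE ?addr_gt0 ?K_gt0 ?ltr0n //.
have := K_gt0; have : 0 <= M.+1%:R :> R by rewrite ler0n.
by case: h; lra.
Qed.

(** Class s collects the atoms that cutting at height M sends to p(s, M); the atoms in no class have
    weight bounded away from 1 in terms of M. *)
Definition cls (M : nat) (k : idx) : option 'S_N.+1 :=
  match k with inl (s, m) => if (M <= m)%N then Some s else None | inr _ => None end.

Lemma prod_wt_ge (k : 'I_N -> idx) i : wt (k i) <= \prod_i wt (k i).
Proof.
rewrite (bigD1 i) //= ler_peMr ?wt_ge0 // .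
by elim/big_ind: _ => // [x y x1 y1|j _]; [rewrite mulr_ege1|exact: wt_ge1].
Qed.

Lemma K2 : 2 <= K.
Proof. by rewrite card_Sn ler_nat (leq_trans _ (fact_geq _)) // ltnS ltnW. Qed.

(** The sum over s is 1 if all atoms of the tuple lie in one class and 0 otherwise. In the latter
    case either an atom outside all classes has a large weight, or two permutations differ and
    [altidx_nonconst] applies. The indicator is written as a sum of products over slots so that it
    survives multilinear expansion. *)
Lemma altidx_bound M (k : 'I_N -> idx) :
  `|altidx k| <= (1 - gap M + gap M * \sum_s \prod_i (cls M (k i) == Some s)%:R)
     * \prod_i wt (k i).
Proof.
have e0 := gap_gt0 M; have i0 : 'I_N := Ordinal (ltnW N2).
have P1 : 1 <= \prod_i wt (k i) := le_trans (wt_ge1 _) (prod_wt_ge k i0).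
have Sge0 : 0 <= \sum_s \prod_i (cls M (k i) == Some s)%:R :> R.
  by apply: sumr_ge0 => s _; apply: prodr_ge0.
have e1 : gap M <= 1 by rewrite -invr1 gap_le //; right; rewrite ler1n.
suff bad : `|altidx k| <= (1 - gap M) * \prod_i wt (k i) \/
    1 <= \sum_s \prod_i (cls M (k i) == Some s)%:R :> R.
  case: bad => [bad|S1].
    by rewrite (le_trans bad) // ler_wpM2r ?(le_trans _ P1) // lerDl mulr_ge0 // ltW.
  rewrite (le_trans (altidx_norm k)) // (le_trans P1) // ler_peMl ?(le_trans _ P1) //.
  by rewrite -subr_ge0; nra.
have small i : (wt (k i))^-1 <= 1 - gap M ->
    `|altidx k| <= (1 - gap M) * \prod_i wt (k i).
  move=> h; rewrite (le_trans (altidx_norm k)) //.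
  rewrite (@le_trans _ _ ((1 - gap M) * wt (k i))) //.
    by rewrite -ler_pdivrMr ?mul1r // (lt_le_trans _ (wt_ge1 _)).
  by rewrite ler_wpM2l ?prod_wt_ge // subr_ge0.
have [/existsP[i /eqP ki]|/existsPn hk] := boolP [exists i, cls M (k i) == None].
  left; apply: (small i); move: ki; case: (k i) => [[s m]|[a b]] /=; last first.
    move=> _; have := @gap_le M 2 (ltr0n R 2) (or_introl K2).
    by rewrite (_ : 2^-1 = 1 - 2^-1) //; lra.
  case: leqP => // mM _.
  have -> : (1 + m.+1%:R^-1)^-1 = 1 - m.+2%:R^-1 :> R.
    rewrite -[m.+2]addn1 natrD; field.
    have m0 : 0 <= m%:R :> R by rewrite ler0n.
    by apply/andP; split; apply: lt0r_neq0; lra.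
  by rewrite lerD2l lerN2 gap_le ?ltr0n //; right; rewrite ler_nat.
have /fin_all_exists[sm smE] i : exists sm, k i = inl sm /\ (M <= sm.2)%N.
  move: (hk i); case: (k i) => [[s m]|//] /=.
  by case: leqP => // Mm _; exists (s, m).
have kE : k = fun i => inl ((sm i).1, (sm i).2).
  by apply/funext => i; rewrite (smE i).1; case: (sm i).
have [/existsP[i /existsP[j ij]]|/existsPn h] :=
    boolP [exists i, exists j, (sm i).1 != (sm j).1].
  left; have h1 : `|altidx k| <= 1 - K^-1.
    by rewrite kE; exact: (altidx_nonconst (fun i => (sm i).2) ij).
  rewrite (le_trans h1) // (@le_trans _ _ (1 - gap M)) ?ler_peMr ?subr_ge0 //.
  by rewrite lerD2l lerN2 gap_le ?K_gt0 //; left.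
right; rewrite (bigD1 (sm i0).1) //= big1 => [|i _]; last first.
  rewrite (smE i).1; case: (sm i) (h i) (smE i).2 => s m /existsPn/(_ i0) /=.
  by rewrite negbK => /eqP -> ->; rewrite eqxx.
by rewrite lerDl; apply: sumr_ge0 => s _; apply: prodr_ge0.
Qed.

(** * Concentration of mass for combinations of atoms *)

Section Expansion.
Variables (M L : nat) (c : 'I_N -> 'I_L -> R) (k : 'I_N -> 'I_L -> idx).

Let y i a b : R := \sum_j c i j * (entry (k i j) a b)%:R.
Let m i := \sum_j `|c i j| * wt (k i j).
Let q i s := \sum_j `|c i j| * wt (k i j) * (cls M (k i j) == Some s)%:R.

Lemma altform_expand : altform y =
  \sum_(h : {ffun 'I_N -> 'I_L}) (\prod_i c i (h i)) * altidx (fun i => k i (h i)).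
Proof.
under [RHS]eq_bigr do rewrite mulrCA.
rewrite -mulr_sumr; congr (_ * _); under [RHS]eq_bigr do rewrite mulr_sumr.
rewrite [RHS]exchange_big; apply: eq_bigr => p _ /=.
under [RHS]eq_bigr do rewrite mulr_sumr.
rewrite [RHS]exchange_big; apply: eq_bigr => t _ /=.
rewrite bigA_distr_bigA mulr_sumr; apply: eq_bigr => h _ /=.
by rewrite big_split /= mulrCA.
Qed.

(** [altidx_bound] is summed over the multilinear expansion: weights and class indicators factor
    over the slots, so the sums over choice functions h turn back into products of total masses
    [m i] and of class masses [q i s]. *)
Lemma altform_bound :
  `|altform y| <= (1 - gap M) * \prod_i m i + gap M * \sum_s \prod_i q i s.
Proof.
rewrite altform_expand (le_trans (ler_norm_sum _ _ _)) //.
pose w (h : {ffun 'I_N -> 'I_L}) := \prod_i (`|c i (h i)| * wt (k i (h i))).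
apply: (@le_trans _ _ (\sum_h w h * (1 - gap M
    + gap M * \sum_s \prod_i (cls M (k i (h i)) == Some s)%:R))).
  apply: ler_sum => h _; rewrite normrM normr_prod /w big_split /= -mulrA.
  by rewrite ler_wpM2l ?prodr_ge0 // mulrC altidx_bound.
under [leLHS]eq_bigr do rewrite mulrDr.
rewrite big_split /= -mulr_suml mulrC /m bigA_distr_bigA lerD2l.
rewrite /q mulr_sumr; under [leRHS]eq_bigr do rewrite bigA_distr_bigA mulr_sumr.
rewrite exchange_big /=; apply: ler_sum => h _; rewrite mulrCA mulr_sumr mulr_sumr.
by apply: ler_sum => s _; rewrite big_split.
Qed.

Lemma altform_le1 : (forall i, m i <= 1) -> `|altform y| <= 1.
Proof.
move=> m1; rewrite altform_expand (le_trans (ler_norm_sum _ _ _)) //.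
apply: (@le_trans _ _ (\prod_i m i)).
  rewrite /m bigA_distr_bigA; apply: ler_sum => h _.
  rewrite normrM normr_prod big_split /= ler_wpM2l ?prodr_ge0 //.
  pose i0 : 'I_N := Ordinal (ltnW N2).
  by rewrite (le_trans (altidx_norm _)) // (le_trans (wt_ge1 _) (prod_wt_ge _ i0)).
rewrite prodr_ile1 // => i _; rewrite m1 andbT.
by apply: sumr_ge0 => j _; rewrite mulr_ge0 ?wt_ge0.
Qed.

Lemma class_mass_le i : \sum_s q i s <= m i.
Proof.
rewrite exchange_big; apply: ler_sum => j _ /=; rewrite -mulr_sumr.
rewrite ler_piMr ?mulr_ge0 ?wt_ge0 //; case: (cls M (k i j)) => [s|]; last by rewrite big1.
by rewrite (bigD1 s) //= eqxx big1 ?addr0 // => t /negbTE ts; rewrite (inj_eq Some_inj) eq_sym ts.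
Qed.

Lemma class_mass_ge0 i s : 0 <= q i s.
Proof. by apply: sumr_ge0 => j _; rewrite !mulr_ge0 ?wt_ge0. Qed.

(** With D the defect divided by the gap, [altform_bound] gives sum_s prod_i q i s >= 1 - D.
    Choosing s to maximize q i0 yields q i0 s >= 1 - D, so the other classes of slot i0 have total
    mass at most D; pairing slot i0 with slot i then gives q i s >= 1 - 2 D. *)
Lemma mass_concentration : (forall i, m i <= 1) ->
  exists s, forall i, 1 - q i s <= 2 * ((1 - `|altform y|) / gap M).
Proof.
move=> m1; set D := _ / _; have e0 := gap_gt0 M.
have q1 i : \sum_s q i s <= 1 := le_trans (class_mass_le i) (m1 i).
have qs1 i s : q i s <= 1.
  rewrite (le_trans _ (q1 i)) // (bigD1 s) //= lerDl sumr_ge0 // => t _.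
  exact: class_mass_ge0.
have e1 : gap M <= 1 by rewrite -invr1 gap_le //; right; rewrite ler1n.
have DS : 1 - D <= \sum_s \prod_i q i s.
  have := altform_bound.
  have : (1 - gap M) * \prod_i m i <= 1 - gap M.
    rewrite ler_piMr ?subr_ge0 // prodr_ile1 // => i _; rewrite m1 andbT.
    by apply: sumr_ge0 => j _; rewrite mulr_ge0 ?wt_ge0.
  have -> : 1 - D = (`|altform y| - (1 - gap M)) / gap M.
    by rewrite /D; field; rewrite gt_eqF.
  by rewrite ler_pdivrMr //; lra.
have Sij i j : i != j -> \sum_s \prod_l q l s <= \sum_s q i s * q j s.
  move=> ij; apply: ler_sum => s _; rewrite (bigD1 i) //= ler_wpM2l ?class_mass_ge0 //.
  rewrite (bigD1 j) 1?eq_sym //= ler_piMr ?class_mass_ge0 // prodr_ile1 // => l _.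
  by rewrite class_mass_ge0 qs1.
pose i0 : 'I_N := Ordinal (ltnW N2); pose i1 : 'I_N := Ordinal N2.
case: (@arg_maxP _ R _ (1%g : 'S_N.+1) xpredT (q i0)) => // s _ smax; exists s.
have q0 : 1 - D <= q i0 s.
  rewrite (le_trans DS) // (le_trans (@Sij i0 i1 _)) //.
  rewrite (@le_trans _ _ (\sum_t q i0 s * q i1 t)) //.
    by apply: ler_sum => t _; apply: ler_wpM2r; [exact: class_mass_ge0|exact: smax].
  by rewrite -mulr_sumr ler_piMr ?class_mass_ge0.
have D0 : 0 <= D by have := qs1 i0 s; lra.
move=> i; have [->|ii0] := eqVneq i i0; first by lra.
have : \sum_t q i0 t * q i t <= q i s + D.
  rewrite (bigD1 s) //= lerD //.
    by rewrite ler_piMl ?class_mass_ge0.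
  have := q1 i0; rewrite (bigD1 s) //= => h.
  rewrite (@le_trans _ _ (\sum_(t | t != s) q i0 t)) //; last by lra.
  by apply: ler_sum => t _; rewrite ler_piMr ?class_mass_ge0.
have i0i : i0 != i by rewrite eq_sym.
by have := Sij _ _ i0i; lra.
Qed.

End Expansion.

End Combinatorics.

(** * The space F *)

Section SpanOf.
Variables (R : realType) (V : lmodType R).

Lemma span_of_gen (I : Type) (f : I -> V) (u : span_of (range f)) :
  exists (n : nat) (c : 'I_n -> R) (i : 'I_n -> I),
    u = \sum_(j < n) c j *: span_gen (imageT f (i j)).
Proof.
have /asboolP[n [c [v [vf uE]]]] := span_valP u.
have /choice[i iE] j : exists i, f i = v j by have [i _ <-] := vf j; exists i.
exists n, c, i; apply: val_inj; rewrite [RHS]linear_sum [LHS]uE.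
by apply: eq_bigr => j _; rewrite linearZ /= iE.
Qed.

Variables (W : lmodType R) (S : set V) (S' : set W) (A : {linear V -> W}).
Hypothesis AS : forall v, S v -> A v \in in_span S'.

Lemma span_map_subproof u : u \in in_span S -> A u \in in_span S'.
Proof.
move=> /asboolP[n [c [v [vS ->]]]]; rewrite linear_sum rpred_sum // => j _ /=.
by rewrite linearZ rpredZ // AS.
Qed.

Definition span_map (u : span_of S) : span_of S' :=
  Span (span_map_subproof (span_valP u)).

Lemma span_map_linear : linear span_map.
Proof. by move=> a u v; apply: val_inj; rewrite /= linearP. Qed.

HB.instance Definition _ := GRing.isLinear.Build R (span_of S) (span_of S') _
  span_map span_map_linear.

End SpanOf.

Section BaseSpace.
Variables (R : realType) (N : nat).

Definition crd := ('I_N.+1 * 'I_N.+1 + nat)%type.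

(* [atom (inl (s, m))] is the permutation matrix of [s] together with the
   indicator of [0, m]; [atom (inr _)] are the matrix units. *)
Definition atom (k : idx N) : crd -> R^o := fun w =>
  match w with
  | inl (i, j) => (entry k i j)%:R
  | inr q => if k is inl (_, m) then (q <= m)%N%:R else 0
  end.

Definition base := span_of (range atom).

Definition base_atom (k : idx N) : base := span_gen (imageT atom k).

Definition base_norm : base -> R := gauge base_atom (@wt N R).

Lemma base_gen (x : base) : exists (n : nat) (c : 'I_n -> R) (i : 'I_n -> idx N),
  x = \sum_(j < n) c j *: base_atom (i j).
Proof. exact: span_of_gen. Qed.

Lemma base_norm_seminorm : seminorm base_norm.
Proof. apply: gauge_seminorm; [exact: wt_ge0|exact: base_gen]. Qed.

Definition base_coord (w : crd) (x : base) : R^o := val x w.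

Lemma base_coord_linear w : linear (base_coord w).
Proof. by move=> a x y. Qed.

HB.instance Definition _ w := GRing.isLinear.Build R base R^o _
  (base_coord w) (base_coord_linear w).

Lemma atom_norm k w : `|atom k w| <= 1.
Proof.
case: w => [[i j]|q] /=; last case: k => [[s m]|_] /=.
- by rewrite normr_nat lern1 leq_b1.
- by rewrite normr_nat lern1 leq_b1.
- by rewrite normr0.
Qed.

Lemma normr_linear_seminorm (V W : normedModType R) (U : lmodType R)
  (f : {linear U -> W}) : seminorm (fun u => `|f u|).
Proof.
by split=> [x y|a x]; rewrite ?linearD ?ler_normD // linearZ normrZ.
Qed.

Lemma base_coord_norm w x : `|base_coord w x| <= 1 * base_norm x.
Proof.
apply: (gauge_bound (@wt_ge0 N R) base_gen (q := fun x => `|base_coord w x|)) => //.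
  exact: (@normr_linear_seminorm R^o R^o).
by move=> k; rewrite mul1r (le_trans (atom_norm _ _)) // wt_ge1.
Qed.

Definition keep (M : nat) (w : crd) : bool := if w is inr q then (q <= M)%N else true.

Definition raw_trunc M (x : crd -> R^o) : crd -> R^o :=
  fun w => if keep M w then x w else 0.

Lemma raw_trunc_linear M : linear (raw_trunc M).
Proof.
move=> a x y; apply/funext => w.
transitivity (a * raw_trunc M x w + raw_trunc M y w) => //.
by rewrite /raw_trunc; case: ifP => // _; rewrite mulr0 addr0.
Qed.

HB.instance Definition _ M := GRing.isLinear.Build R (crd -> R^o) (crd -> R^o) _
  (raw_trunc M) (raw_trunc_linear M).

Definition trunc_idx (M : nat) (k : idx N) : idx N :=
  if k is inl (s, m) then inl (s, minn m M) else k.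

Lemma raw_trunc_atom M k : raw_trunc M (atom k) = atom (trunc_idx M k).
Proof.
apply/funext => -[[i j]|q]; rewrite /raw_trunc /=; case: k => [[s m]|[a b]] //=.
  by rewrite leq_min; case: (q <= M)%N; rewrite ?andbT ?andbF.
by case: ifP.
Qed.

Lemma raw_trunc_span M v : range atom v -> raw_trunc M v \in in_span (range atom).
Proof. by move=> [k _ <-]; rewrite raw_trunc_atom; apply: in_span_gen; exists (trunc_idx M k). Qed.

Definition trunc M : {linear base -> base} := span_map (@raw_trunc_span M).

Lemma trunc_atom M k : trunc M (base_atom k) = base_atom (trunc_idx M k).
Proof. by apply: val_inj; exact: raw_trunc_atom. Qed.

Lemma base_coord_trunc M w x :
  base_coord w (trunc M x) = if keep M w then base_coord w x else 0.
Proof. by []. Qed.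

Lemma base_norm_atom k : base_norm (base_atom k) <= wt R k.
Proof. by apply: gauge_atom; [exact: wt_ge0|exact: base_gen]. Qed.

(** Lowering m to [minn m M] may raise the weight of an atom, but all weights lie between 1 and
    2. *)
Lemma trunc_norm M x : base_norm (trunc M x) <= 2 * base_norm x.
Proof.
apply: (gauge_bound (@wt_ge0 N R) base_gen (q := fun x => base_norm (trunc M x))) => //.
  have [hD hZ] := base_norm_seminorm.
  by split=> [y z|a y]; rewrite ?linearD ?linearZ ?hD ?hZ.
move=> k; rewrite trunc_atom (le_trans (base_norm_atom _)) //.
by have := wt_le2 R (trunc_idx M k); have := wt_ge1 R k; lra.
Qed.

Lemma trunc_id x : exists M0, forall M, (M0 <= M)%N -> trunc M x = x.
Proof.
have [n [c [i ->]]] := base_gen x; exists (\max_(j < n) if i j is inl (_, m) then m else 0).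
move=> M M0; rewrite linear_sum; apply: eq_bigr => j _; rewrite linearZ trunc_atom.
congr (_ *: base_atom _); have := leq_trans (leq_bigmax j) M0.
by case: (i j) => [[s m]|//] /= mM; rewrite (minn_idPl mM).
Qed.

End BaseSpace.

Arguments trunc {R N} M.
Arguments base_atom {R N} k.

Section FactorMaps.
Variables (R : realType) (N : nat) (F : completeNormedModType R).
Variable (j0 : {linear base R N -> F}).
Hypothesis j0P : is_completion (@base_norm R N) j0.

Lemma coord_exists : exists coord : crd N -> {linear F -> R^o},
  (forall w x, coord w (j0 x) = base_coord w x) /\ (forall w y, `|coord w y| <= `|y|).
Proof.
have /choice[coord cP] (w : crd N) : exists c : {linear F -> R^o},
    (forall x, c (j0 x) = base_coord w x) /\ (forall y, `|c y| <= 1 * `|y|).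
  by apply: (completion_extend j0P) => // x; exact: base_coord_norm.
exists coord; split=> [w x|w y]; first by have [->] := cP w.
by have [_ /(_ y)] := cP w; rewrite mul1r.
Qed.

Lemma cut_exists : exists cut : nat -> {linear F -> F},
  (forall M x, cut M (j0 x) = j0 (trunc M x)) /\ (forall M y, `|cut M y| <= 2 * `|y|).
Proof.
have /choice[cut cP] M : exists c : {linear F -> F},
    (forall x, c (j0 x) = j0 (trunc M x)) /\ (forall y, `|c y| <= 2 * `|y|).
  apply: (completion_extend j0P (L := j0 \o trunc M)) => // x.
  by rewrite j0P.1 trunc_norm.
by exists cut; split=> [M x|M y]; have [h1 h2] := cP M.
Qed.

End FactorMaps.

(* [cut M] replaces the indicator of [0, m] by that of [0, minn m M]. *)
Record factor_space (R : realType) (N : nat) (F : completeNormedModType R) := FactorSpace {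
  emb : {linear base R N -> F};
  embP : is_completion (@base_norm R N) emb;
  coord : crd N -> {linear F -> R^o};
  coord_emb : forall w x, coord w (emb x) = base_coord w x;
  coord_norm : forall w y, `|coord w y| <= `|y|;
  cut : nat -> {linear F -> F};
  cut_emb : forall M x, cut M (emb x) = emb (trunc M x);
  cut_norm : forall M y, `|cut M y| <= 2 * `|y| }.

Lemma factor_space_exists (R : realType) (N : nat) :
  exists F : completeNormedModType R, inhabited (factor_space N F).
Proof.
have [F [j jP]] := completion_exists (@base_norm_seminorm R N).
have [coord [coordE coord_le]] := coord_exists jP.
have [cut [cutE cut_le]] := cut_exists jP.
by exists F; split; exact: (FactorSpace jP coordE coord_le cutE cut_le).
Qed.

(** * Near-maximizers of the alternating form on F *)

Section FactorTheory.
Variables (R : realType) (N : nat) (F : completeNormedModType R) (X : factor_space N F).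
Hypothesis N2 : (2 <= N)%N.

Definition peak (s : 'S_N.+1) (m : nat) : F := emb X (base_atom (inl (s, m))).

Lemma norm_peak s m : `|peak s m| <= 1 + m.+1%:R^-1.
Proof. by rewrite (embP X).1 base_norm_atom. Qed.

Lemma norm_peak2 s m : `|peak s m| <= 2.
Proof. by rewrite (le_trans (norm_peak s m)) // (wt_le2 R (inl (s, m) : idx N)). Qed.

Lemma coord_peak w s m : coord X w (peak s m) = atom R (inl (s, m)) w.
Proof. by rewrite coord_emb. Qed.

Lemma coord_cut w M y :
  coord X w (cut X M y) = if keep M w then coord X w y else 0.
Proof.
pose g : {linear F -> R^o} := if keep M w then coord X w else \0%R.
have gE z : g z = if keep M w then coord X w z else 0 by rewrite /g; case: ifP.
rewrite -gE; apply: (completion_ext (embP X) (f := coord X w \o cut X M) (C := 2)).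
- by move=> t; rewrite (le_trans (coord_norm _ _ _)) // cut_norm.
- move=> t; rewrite gE; case: ifP => _; last by rewrite normr0 mulr_ge0.
  by rewrite (le_trans (coord_norm _ _ _)) // ler_peMl // ler1n.
- by move=> v; rewrite gE /= cut_emb !coord_emb base_coord_trunc.
Qed.

Definition altF (y : 'I_N -> F) : R := altform (fun i a b => coord X (inl (a, b)) (y i)).

Lemma altF_peak (s : 'S_N.+1) (m : 'I_N -> nat) :
  altF (fun i => peak s (m i)) = (-1) ^+ s.
Proof.
rewrite -(altidx_const R s m) /altF /altidx; congr altform.
by apply/funext => i; apply/funext => a; apply/funext => b; rewrite coord_peak.
Qed.

(** Padding with zero coefficients gives the representations of all slots one common length, as the
    multilinear expansion requires. *)
Lemma atomic_pad (L : nat) (l : seq (R * idx N)) : (size l <= L)%N ->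
  exists (c : 'I_L -> R) (k : 'I_L -> idx N),
    \sum_j c j *: base_atom (k j) = atomic base_atom l /\
    \sum_j `|c j| * wt R (k j) = mass (@wt N R) l.
Proof.
move=> lL; pose x0 : R * idx N := (0, inl (1%g, 0%N)).
pose l' := l ++ nseq (L - size l) x0.
have sl' : size l' = L by rewrite size_cat size_nseq subnKC.
exists (fun j => (nth x0 l' j).1), (fun j => (nth x0 l' j).2); split.
  rewrite -(big_mkord xpredT (fun j => (nth x0 l' j).1 *: base_atom (nth x0 l' j).2)).
  rewrite -{1}sl' -(big_nth x0 xpredT (fun x => x.1 *: base_atom x.2)) big_cat /=.
  by rewrite [X in _ + X]big1_seq ?addr0 // => x /nseqP[-> _]; rewrite scale0r.
rewrite -(big_mkord xpredT (fun j => `|(nth x0 l' j).1| * wt R (nth x0 l' j).2)).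
rewrite -{1}sl' -(big_nth x0 xpredT (fun x => `|x.1| * wt R x.2)) big_cat /=.
by rewrite [X in _ + X]big1_seq ?addr0 // => x /nseqP[-> _]; rewrite normr0 mul0r.
Qed.

(** Each [y i] is first shrunk by 1 - d: this leaves room for the errors of density and of the
    infimum, so that the mass stays at most 1. *)
Lemma ball_approx (y : 'I_N -> F) (d : R) : (forall i, `|y i| <= 1) -> 0 < d -> d < 1 ->
  exists (L : nat) (c : 'I_N -> 'I_L -> R) (k : 'I_N -> 'I_L -> idx N),
    (forall i, \sum_j `|c i j| * wt R (k i j) <= 1) /\
    (forall i, `|y i - emb X (\sum_j c i j *: base_atom (k i j))| <= 2 * d).
Proof.
move=> y1 d0 d1; have d2 := divr_gt0 d0 (ltr0n R 2).
have /choice[l lP] i : exists l : seq (R * idx N), mass (@wt N R) l <= 1 /\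
    `|y i - emb X (atomic base_atom l)| <= 2 * d.
  have [x xy] := completion_approx (embP X) ((1 - d) *: y i) d2.
  have y0 := normr_ge0 (y i); have yi1 := y1 i.
  have ny : `|(1 - d) *: y i| <= 1 - d.
    by rewrite normrZ [`|1 - d|]ger0_norm ?subr_ge0 ?(ltW d1) // ler_piMr ?subr_ge0 ?(ltW d1).
  have x1 : base_norm x < 1 - d / 2.
    rewrite -(embP X).1; have := ler_distD ((1 - d) *: y i) (emb X x) 0.
    by rewrite !subr0 [`|emb X x - _|]distrC; lra.
  have [l xl lx] := gauge_approx (@wt_ge0 N R) (@base_gen R N) x d2.
  exists l; rewrite -xl; split.
    by apply: ltW; apply: (lt_le_trans lx); have := x1; rewrite /base_norm; lra.
  have := ler_distD ((1 - d) *: y i) (y i) (emb X x).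
  have -> : `|y i - (1 - d) *: y i| = d * `|y i|.
    by rewrite scalerBl scale1r opprB addrC subrK normrZ [`|d|]gtr0_norm.
  by have : d * `|y i| <= d * 1; [rewrite ler_wpM2l // ltW|lra].
pose L := \max_i size (l i).
have /choice[c cP] i := @atomic_pad L (l i) (leq_bigmax i).
have /choice[k kP] := cP.
exists L, c, k; split=> i; have [h1 h2] := kP i; have [l1 l2] := lP i.
  by rewrite h2.
by rewrite h1.
Qed.

Lemma coord_comb L (c : 'I_L -> R) (k : 'I_L -> idx N) a b :
  coord X (inl (a, b)) (emb X (\sum_j c j *: base_atom (k j)))
    = \sum_j c j * (entry (k j) a b)%:R.
Proof. by rewrite !linear_sum; apply: eq_bigr => j _; rewrite !linearZ /= coord_emb. Qed.

Lemma norm_comb L (c : 'I_L -> R) (k : 'I_L -> idx N) :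
  `|emb X (\sum_j c j *: base_atom (k j))| <= \sum_j `|c j| * wt R (k j).
Proof.
rewrite linear_sum (le_trans (ler_norm_sum _ _ _)) //; apply: ler_sum => j _.
by rewrite linearZ normrZ ler_wpM2l // (embP X).1 base_norm_atom.
Qed.

Let lipK : R := #|{: 'S_N.+1}|%:R * N%:R.

Lemma altF_approx (y z : 'I_N -> F) d : (forall i, `|y i| <= 1) ->
  (forall i, `|z i| <= 1) -> (forall i, `|y i - z i| <= d) ->
  `|altF y - altF z| <= lipK * d.
Proof.
move=> y1 z1 yz; apply: altform_lipschitz => i a b.
- by rewrite (le_trans (coord_norm _ _ _)).
- by rewrite (le_trans (coord_norm _ _ _)).
- by rewrite -linearB (le_trans (coord_norm _ _ _)).
Qed.

Lemma altF_comb L (c : 'I_N -> 'I_L -> R) (k : 'I_N -> 'I_L -> idx N) :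
  altF (fun i => emb X (\sum_j c i j *: base_atom (k i j)))
    = altform (fun i a b => \sum_j c i j * (entry (k i j) a b)%:R).
Proof.
congr altform; apply/funext => i; apply/funext => a; apply/funext => b.
exact: coord_comb.
Qed.

Lemma altF_le1 (y : 'I_N -> F) : (forall i, `|y i| <= 1) -> `|altF y| <= 1.
Proof.
move=> y1; apply/ler_addgt0Pr => e e0.
have lK : 0 <= lipK by rewrite mulr_ge0.
have [d d0 [d1 dE]] : exists2 d : R, 0 < d & d < 1 /\ lipK * (2 * d) <= e.
  have b0 : 0 < 1 + 2 * lipK + e by lra.
  exists (e / (1 + 2 * lipK + e)); first exact: divr_gt0.
  rewrite ltr_pdivrMr // mul1r ltrDr; split; first by lra.
  rewrite mulrA mulrCA -[leRHS]mulr1 ler_pM2l // ler_pdivrMr // mul1r; lra.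
have [L [c [k [m1 yE]]]] := ball_approx y1 d0 d1.
pose z i := emb X (\sum_j c i j *: base_atom (k i j)).
have z1 i : `|z i| <= 1 := le_trans (norm_comb _ _) (m1 i).
have h1 : `|altF z| <= 1 by rewrite altF_comb altform_le1.
have h2 := altF_approx y1 z1 yE.
have := ler_distD (altF z) (altF y) 0; rewrite !subr0; lra.
Qed.

(** Atoms of class s are cut exactly to p(s, M). With [th i] the sum of the coefficients in class s,
    only the mass outside that class counts; its atoms are cut to norm at most 2, and
    [mass_concentration] bounds it by twice the defect over the gap. The term e absorbs the
    approximation by finite combinations. *)
Lemma altF_near_max (M : nat) (y : 'I_N -> F) (e : R) :
    (forall i, `|y i| <= 1) -> 0 < e ->
  exists (s : 'S_N.+1) (th : 'I_N -> R), (forall i, `|th i| <= 1) /\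
    forall i, `|cut X M (y i) - th i *: peak s M|
      <= 4 * ((1 - `|altF y|) / gap N R M) + e.
Proof.
move=> y1 e0; set et := gap N R M; have et0 : 0 < et := gap_gt0 N R M.
have lK : 0 <= lipK / et by rewrite !mulr_ge0 // invr_ge0 ltW.
have [d d0 [d1 dE]] : exists2 d : R, 0 < d &
    d < 1 /\ 4 * d + 4 * (lipK * (2 * d) / et) <= e.
  have b0 : 0 < 4 + 8 * (lipK / et) + e by move: (lipK / et) lK => q q0; lra.
  exists (e / (4 + 8 * (lipK / et) + e)); first exact: divr_gt0.
  rewrite ltr_pdivrMr // mul1r ltrDr; split.
    by move: (lipK / et) lK => q q0; lra.
  set b := 4 + _ + _; have -> : 4 * (e / b) + 4 * (lipK * (2 * (e / b)) / et)
      = e * ((4 + 8 * (lipK / et)) / b) by field; rewrite !gt_eqF.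
  rewrite -[leRHS]mulr1 ler_pM2l // ler_pdivrMr // mul1r lerDl ltW //.
have [L [c [k [m1 yE]]]] := ball_approx y1 d0 d1.
pose z i := emb X (\sum_j c i j *: base_atom (k i j)).
have z1 i : `|z i| <= 1 := le_trans (norm_comb _ _) (m1 i).
have h2 := altF_approx y1 z1 yE.
have [s sP] := @mass_concentration N N2 R M L c k m1.
exists s, (fun i => \sum_j c i j * (cls M (k i j) == Some s)%:R); split=> i.
  rewrite (le_trans (ler_norm_sum _ _ _)) // (le_trans _ (m1 i)) //.
  apply: ler_sum => j _; rewrite normrM ler_wpM2l // normr_nat.
  by rewrite (le_trans _ (wt_ge1 _ _)) // lern1 leq_b1.
set th := \sum_j _.
have h3 : `|cut X M (z i) - th *: peak s M|
    <= 2 * (\sum_j `|c i j| * wt R (k i j)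
       - \sum_j `|c i j| * wt R (k i j) * (cls M (k i j) == Some s)%:R).
  rewrite /z cut_emb /peak -linearZ -linearB.
  rewrite linear_sum /th scaler_suml -sumrB -sumrB mulr_sumr linear_sum.
  rewrite (le_trans (ler_norm_sum _ _ _)) //; apply: ler_sum => j _.
  rewrite [trunc M _]linearZ trunc_atom; case: eqP => [|_].
    case: (k i j) => [[s' m]|[a b]] //=; case: leqP => // Mm [->].
    by rewrite !mulr1 !subrr linear0 normr0 mulr0.
  rewrite !mulr0 scale0r !subr0 linearZ normrZ mulrCA ler_wpM2l //.
  rewrite (embP X).1 (le_trans (base_norm_atom _ _)) //.
  by have := wt_le2 R (trunc_idx M (k i j)); have := wt_ge1 R (k i j); lra.
have h4 := sP i; have := m1 i.
have h5 : `|cut X M (y i) - cut X M (z i)| <= 4 * d.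
  rewrite -linearB (le_trans (cut_norm _ _ _)) //.
  by have := yE i; rewrite -/(z i); lra.
have h6 := ler_distD (cut X M (z i)) (cut X M (y i)) (th *: peak s M).
have h7 : (1 - `|altF z|) / et <= (1 - `|altF y|) / et + lipK * (2 * d) / et.
  rewrite -mulrDl ler_wpM2r ?invr_ge0 ?(ltW et0) //.
  have := ler_distD (altF z) (altF y) 0; rewrite !subr0; lra.
move: h4 h7; rewrite -altF_comb -/z -/et.
by move: h3 h5 h6 dE; lra.
Qed.

End FactorTheory.

(** * Multilinear forms and alternating sums *)

Section Forms.
Variables (R : realType) (N : nat) (F : completeNormedModType R).

Local Notation form := (multilinear_form (fun _ : 'I_N => F)).

Lemma mform_ext (B : form) (x y : 'I_N -> F) : (forall i, x i = y i) -> B x = B y.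
Proof. by move=> xy; congr (mform_val B _); apply/funext. Qed.

Lemma dfwithE (x : 'I_N -> F) i y j : dfwith x i y j = if j == i then y else x j.
Proof. by case: eqVneq => [->|ji]; [rewrite dfwithin|rewrite dfwithout // eq_sym]. Qed.

Lemma prod_form_linear (l : 'I_N -> {linear F -> R^o}) (x : 'I_N -> F) (i : 'I_N) :
  linear (fun y : F => \prod_j l j (dfwith x i y j) : R^o).
Proof.
move=> a y z; rewrite !(bigD1 i (P := xpredT)) //= !dfwithE eqxx linearP.
have h w : \prod_(j | j != i) l j (dfwith x i w j) = \prod_(j | j != i) l j (x j).
  by apply: eq_bigr => j ji; rewrite dfwithE (negbTE ji).
by rewrite !h mulrDl -scalerAl.
Qed.

Definition prod_form (l : 'I_N -> {linear F -> R^o}) : form :=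
  @MultilinearForm R N (fun _ => F) (fun x => \prod_j l j (x j)) (prod_form_linear l).

Lemma pull_form_linear (A : {linear F -> F}) (B : form) (x : 'I_N -> F) (i : 'I_N) :
  linear (fun y : F => B (fun j => A (dfwith x i y j)) : R^o).
Proof.
have h y : B (fun j => A (dfwith x i y j)) = B (dfwith (fun j => A (x j)) i (A y)).
  by apply: mform_ext => j; rewrite !dfwithE; case: ifP.
by move=> a y z; rewrite !h linearP (mform_linear B).
Qed.

Definition pull_form (A : {linear F -> F}) (B : form) : form :=
  @MultilinearForm R N (fun _ => F) (fun x => B (fun j => A (x j))) (pull_form_linear A B).

Definition slot_map (B : form) (x : 'I_N -> F) (i : 'I_N) : F -> R^o :=
  fun y => B (dfwith x i y).

Lemma slot_map_linear B x i : linear (slot_map B x i).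
Proof. exact: (mform_linear B). Qed.

HB.instance Definition _ B x i := GRing.isLinear.Build R F R^o _
  (slot_map B x i) (slot_map_linear B x i).

Lemma slot_mapZ (B : form) x i a y : slot_map B x i (a *: y) = a * slot_map B x i y.
Proof. exact: (linearZ_LR (slot_map B x i : {linear F -> R^o})). Qed.

Lemma slot_mapD (B : form) x i y z :
  slot_map B x i (y + z) = slot_map B x i y + slot_map B x i z.
Proof. exact: (linearD (slot_map B x i : {linear F -> R^o})). Qed.

Lemma slot_map_sum (B : form) x i (I : finType) (f : I -> F) :
  slot_map B x i (\sum_j f j) = \sum_j slot_map B x i (f j).
Proof. exact: (linear_sum (slot_map B x i : {linear F -> R^o})). Qed.

Definition hybrid (k : nat) (x y : 'I_N -> F) : 'I_N -> F :=
  fun i => if (i < k)%N then y i else x i.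

Lemma hybrid0 (B : form) x y : B (hybrid 0 x y) = B x.
Proof. exact: mform_ext. Qed.

Lemma hybridN (B : form) x y : B (hybrid N x y) = B y.
Proof. by apply: mform_ext => i; rewrite /hybrid ltn_ord. Qed.

Lemma hybridS (B : form) x y (k : 'I_N) :
  B (hybrid k.+1 x y) = slot_map B (hybrid k x y) k (y k).
Proof.
apply: mform_ext => i; rewrite dfwithE /hybrid ltnS leq_eqVlt val_eqE.
by case: eqVneq => [->|].
Qed.

Lemma hybridE (B : form) x y (k : 'I_N) :
  B (hybrid k x y) = slot_map B (hybrid k x y) k (x k).
Proof.
apply: mform_ext => i; rewrite dfwithE /hybrid.
by case: eqVneq => [->|//]; rewrite ltnn.
Qed.

Lemma mform_telescope (B : form) x y :
  B x - B y = \sum_(k < N) slot_map B (hybrid k x y) k (x k - y k).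
Proof.
under eq_bigr do rewrite linearB /= -hybridE -hybridS.
have := telescope_sumr (fun k => - B (hybrid k x y)) (leq0n N).
rewrite big_mkord hybrid0 hybridN opprK addrC => <-.
by apply: eq_bigr => k _; rewrite opprK addrC.
Qed.

Lemma mform_scale (B : form) (c : 'I_N -> R) (x : 'I_N -> F) :
  B (fun i => c i *: x i) = (\prod_i c i) * B x.
Proof.
pose y i := c i *: x i.
have h k : (k <= N)%N ->
    B (hybrid k x y) = (\prod_(i < N | (i < k)%N) c i) * B x.
  elim: k => [_|k IH kN]; first by rewrite hybrid0 big_pred0 // mul1r.
  have -> : B (hybrid k.+1 x y) = c (Ordinal kN) * B (hybrid k x y).
    rewrite (hybridS B x y (Ordinal kN)) (hybridE B x y (Ordinal kN)).
    exact: slot_mapZ.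
  rewrite IH 1?ltnW //.
  rewrite [in RHS](bigD1 (Ordinal kN)) //= -mulrA; congr (_ * (_ * _)).
  by apply: eq_bigl => i; rewrite -val_eqE /= ltnS; case: ltngtP.
rewrite -[LHS](hybridN B x) h //; congr (_ * _).
by apply: eq_bigl => i; rewrite ltn_ord.
Qed.

End Forms.

Section Alternating.
Variables (R : realType) (N : nat) (F : completeNormedModType R) (X : factor_space N F).

Lemma sum_sign_invol (g : 'S_N.+1 -> R) a b : a != b ->
  (forall s, g (tperm a b * s)%g = g s) ->
  \sum_(s : 'S_N.+1) (-1) ^+ s * g s = 0.
Proof.
move=> ab gE; set S := \sum_(s : 'S_N.+1) _.
suff : S = - S by move=> /eqP; rewrite -subr_eq0 opprK -mulr2n mulrn_eq0 => /eqP.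
rewrite {1}/S (reindex_inj (mulgI (tperm a b))) /= -sumrN; apply: eq_bigr => s _.
by rewrite gE odd_mul_tperm ab signr_addb expr1 mulN1r mulNr.
Qed.

Lemma sum_sign_cylinder (l : seq ('I_N.+1 * 'I_N.+1)) : (size l < N)%N ->
  \sum_(s : 'S_N.+1) (-1) ^+ s * \prod_(ab <- l) (s ab.1 == ab.2)%:R = 0 :> R.
Proof.
move=> lN; pose rows := [pred i | i \in map fst l].
have /card_gt1P[a [b [al bl ab]]] : (1 < #|[predC rows]|)%N.
  have := cardC rows; rewrite card_ord => h.
  have rl : (#|rows| <= size l)%N by rewrite -(size_map fst); exact: card_size.
  by rewrite -(ltn_add2l #|rows|) h addn1 ltnS (leq_ltn_trans rl).
apply: (@sum_sign_invol _ a b) => // s; apply: eq_big_seq => -[i j] ijl /=.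
have il : i \in map fst l by apply/mapP; exists (i, j).
rewrite permM tpermD //; first by apply: contraNneq al => ->.
by apply: contraNneq bl => ->.
Qed.

Definition munit a b : F := emb X (base_atom (inr (a, b))).

(** All dependence on s is carried by matrix units with coefficients 0 or 1. The first summand is
    the indicator of [0, m], obtained inside [F] with the help of the identity permutation. *)
Lemma peak_split s m : peak X s m =
  (peak X 1%g m - \sum_a munit a a) + \sum_a \sum_b (s a == b)%:R *: munit a b.
Proof.
have h t : \sum_a \sum_b ((t : 'S_N.+1) a == b)%:R *: munit a b = \sum_a munit a (t a).
  apply: eq_bigr => a _; rewrite (bigD1 (t a)) //= eqxx scale1r big1 ?addr0 // => b.
  by rewrite eq_sym => /negbTE ->; rewrite scale0r.
rewrite h /peak /munit -!linear_sum -linearB -linearD; congr (emb X _).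
apply: val_inj; apply/funext => w.
have ev (x : base R N) : val x w = base_coord w x by [].
rewrite !ev linearD linearB !linear_sum /= sumrN {ev}.
case: w => [[i j]|q]; rewrite /base_coord /=; last by rewrite !big1 // subr0 addr0.
have sumE (t : 'S_N.+1) :
    \sum_(a : 'I_N.+1) ((a == i) && (t a == j))%:R = (t i == j)%:R :> R.
  rewrite (bigD1 i) //= eqxx big1 ?addr0 // => a /negbTE -> //.
have sum1 : \sum_(a : 'I_N.+1) ((a == i) && (a == j))%:R = (i == j)%:R :> R.
  by have := sumE 1%g; rewrite perm1 => <-; apply: eq_bigr => a _; rewrite perm1.
by rewrite (sumE s) sum1 perm1 subrr add0r.
Qed.

Lemma peak_diff s m m' : peak X s m - peak X s m' = peak X 1%g m - peak X 1%g m'.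
Proof.
rewrite (peak_split s m) (peak_split s m') opprD addrACA subrr addr0.
by rewrite opprB addrA subrK.
Qed.

(** Induction on the slots S that hold p(s, .): [peak_split] in one slot gives a term where that
    slot no longer depends on s, and terms where it is traded for one condition s a = b in l.
    Neither raises [size l + size S], and for empty S [sum_sign_cylinder] applies. *)
Lemma sum_sign_form (B : multilinear_form (fun _ : 'I_N => F)) (m : 'I_N -> nat)
    (S : seq 'I_N) : uniq S ->
  forall (l : seq ('I_N.+1 * 'I_N.+1)) (x : 'I_N -> F), (size l + size S < N)%N ->
  \sum_(s : 'S_N.+1) (-1) ^+ s * ((\prod_(ab <- l) (s ab.1 == ab.2)%:R) *
    B (fun i => if i \in S then peak X s (m i) else x i)) = 0.
Proof.
elim: S => [_ l x|i S IH /= /andP[iS uS] l x]; rewrite ?addn0 => lN.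
  transitivity ((\sum_(s : 'S_N.+1) (-1) ^+ s *
      \prod_(ab <- l) (s ab.1 == ab.2)%:R) * B x).
    rewrite mulr_suml; apply: eq_bigr => s _; rewrite [LHS]mulrA; congr (_ * _).
  by rewrite sum_sign_cylinder // mul0r.
pose fam s (z : 'I_N -> F) j := if j \in S then peak X s (m j) else z j.
have famE s e : slot_map B (fam s x) i e = B (fam s (dfwith x i e)).
  apply: mform_ext => j; rewrite /fam !dfwithE; case: eqVneq => [->|//].
  by rewrite (negbTE iS).
have step s : B (fun j => if j \in i :: S then peak X s (m j) else x j) =
    B (fam s (dfwith x i (peak X 1%g (m i) - \sum_a munit a a))) +
    \sum_a \sum_b (s a == b)%:R * B (fam s (dfwith x i (munit a b))).
  transitivity (slot_map B (fam s x) i (peak X s (m i))).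
    by apply: mform_ext => j; rewrite dfwithE /fam inE; case: eqVneq => [->|].
  rewrite peak_split slot_mapD famE slot_map_sum; congr (_ + _); apply: eq_bigr => a _.
  by rewrite slot_map_sum; apply: eq_bigr => b _; rewrite slot_mapZ famE.
under eq_bigr do rewrite step !mulrDr.
rewrite big_split /= IH // ?add0r; last by rewrite (leq_ltn_trans _ lN) // leq_add2l.
under eq_bigr do rewrite !mulr_sumr.
rewrite exchange_big big1 // => a _ /=; under eq_bigr do rewrite !mulr_sumr.
rewrite exchange_big big1 // => b _ /=.
have := IH uS ((a, b) :: l) (dfwith x i (munit a b)); rewrite /= addSnnS => /(_ lN) h.
rewrite -[RHS]h; apply: eq_bigr => s _; rewrite big_cons /=.
by congr (_ * _); rewrite mulrCA mulrA.
Qed.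

(** In the telescoping sum slot k carries a difference that by [peak_diff] is independent of s. The
    other N - 1 slots have height m' before k and m after it, hence the slotwise heights in
    [sum_sign_form]. *)
Lemma sum_sign_peak (B : multilinear_form (fun _ : 'I_N => F)) m m' :
  \sum_(s : 'S_N.+1) (-1) ^+ s * B (fun=> peak X s m) =
  \sum_(s : 'S_N.+1) (-1) ^+ s * B (fun=> peak X s m').
Proof.
apply/eqP; rewrite -subr_eq0 -sumrB; apply/eqP.
under eq_bigr do rewrite -mulrBr mform_telescope mulr_sumr.
rewrite exchange_big big1 // => k _ /=.
pose S := rem k (enum 'I_N).
have uS : uniq S by rewrite rem_uniq // enum_uniq.
have Si i : (i \in S) = (i != k) by rewrite mem_rem_uniq ?enum_uniq // !inE mem_enum andbT.
have sS : size S = N.-1 by rewrite size_rem ?mem_enum // size_enum_ord.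
have N0 : (0 < N)%N by rewrite (leq_ltn_trans _ (ltn_ord k)).
pose mm (i : 'I_N) := if (i < k)%N then m' else m.
have := @sum_sign_form B mm S uS [::] (fun=> peak X 1%g m - peak X 1%g m').
rewrite add0n sS prednK // leqnn => /(_ isT) h.
rewrite -[RHS]h; apply: eq_bigr => s _; rewrite big_nil mul1r; congr (_ * _).
apply: mform_ext => i; rewrite dfwithE Si /hybrid /mm; case: eqVneq => [_|_] /=.
  exact: peak_diff.
by case: ifP.
Qed.

End Alternating.

(** * The exposed point *)

(** With z = [ord_max], (a b) = (a z)(b z)(a z), so g changes sign under every transposition, and
    these generate the group. *)
Lemma perm_sign_unique (R : realType) (N : nat) (g : 'S_N.+1 -> R) :
    (forall (r : 'I_N) t, g (tperm (wid r) ord_max * t)%g = - g t) ->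
  forall s, g s = (-1) ^+ s * g 1%g.
Proof.
move=> flip; have flipm (a : 'I_N.+1) t : a != ord_max -> g (tperm a ord_max * t)%g = - g t.
  by move=> /widP[r ->].
have flips (a b : 'I_N.+1) t : a != b -> g (tperm a b * t)%g = - g t.
  move=> ab; have [am|am] := eqVneq a ord_max.
    by rewrite tpermC am flipm // -am eq_sym.
  have [->|bm] := eqVneq b ord_max; first exact: flipm.
  have -> : tperm a b = (tperm a ord_max * (tperm b ord_max * tperm a ord_max))%g.
    have := tpermJ b ord_max (tperm a ord_max).
    have -> : tperm a ord_max b = b by rewrite tpermD // eq_sym.
    by rewrite tpermR conjgE tpermV => ->; rewrite tpermC.
  by rewrite -!mulgA !flipm // opprK.
move=> s; have [ts -> {s}] := prod_tpermP s.
elim: ts => [_|[a b] ts IH /= /andP[ab /IH h]]; first by rewrite big_nil odd_perm1 mul1r.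
by rewrite big_cons /= flips // h odd_mul_tperm ab signr_addb expr1 mulN1r mulNr.
Qed.

(* Common interface of the full and the symmetric tensor products of [F]:
   [tat i] is the tensor of the tuple [ttup i], arbitrary in the former case and
   constant in the latter. *)
Record tensor_model (R : realType) (N : nat) (F : completeNormedModType R) := TensorModel {
  tsp :> lmodType R;
  tind : Type;
  ttup : tind -> 'I_N -> F;
  tat : tind -> tsp;
  tev : {linear tsp -> (multilinear_form (fun _ : 'I_N => F) -> R^o)};
  tev_at : forall i B, tev (tat i) B = B (ttup i);
  tev_inj : forall u v, (forall B, tev u B = tev v B) -> u = v;
  tgen : forall u, exists (n : nat) (c : 'I_n -> R) (i : 'I_n -> tind),
    u = \sum_(j < n) c j *: tat (i j);
  tmap : {linear F -> F} -> {linear tsp -> tsp};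
  tmapE : forall A u B, tev (tmap A u) B = tev u (pull_form A B);
  tmap_ind : forall (A : {linear F -> F}) i, exists i', forall s, ttup i' s = A (ttup i s);
  tunit_ind : forall i, exists i', forall s, ttup i' s = `|ttup i s|^-1 *: ttup i s;
  tcst : F -> tind;
  tcstE : forall x s, ttup (tcst x) s = x;
  tline_ind : forall i x (c : 'I_N -> R) h, (forall s, `|c s| <= 1) ->
    (forall s, `|ttup i s - c s *: x| <= h) -> exists i' (d : 'I_N -> R),
    [/\ forall s, `|d s| <= 1, forall s, ttup i' s = d s *: x
      & forall s, `|ttup i s - ttup i' s| <= h];
  tcont : exists2 C : R, 0 < C & forall i i' h,
    (forall s, `|ttup i s| <= 2) -> (forall s, `|ttup i' s| <= 2) ->
    (forall s, `|ttup i s - ttup i' s| <= h) ->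
    gauge tat (fun i => \prod_s `|ttup i s|) (tat i - tat i') <= C * h }.

(** * Tensor norm, alternating functional and witness in a common model *)

Section Model.
Variables (R : realType) (N : nat) (F : completeNormedModType R) (X : factor_space N F).
Variable (V : tensor_model N F).
Hypothesis N2 : (2 <= N)%N.

Local Notation form := (multilinear_form (fun _ : 'I_N => F)).
Local Notation K := (#|{: 'S_N.+1}|%:R : R).

Definition tw (i : tind V) : R := \prod_s `|ttup i s|.

Definition tnorm : V -> R := gauge (@tat _ _ _ V) tw.

Lemma tw_ge0 i : 0 <= tw i. Proof. exact: prodr_ge0. Qed.

Lemma tnorm_seminorm : seminorm tnorm.
Proof. apply: gauge_seminorm; [exact: tw_ge0|exact: tgen]. Qed.

Lemma tnorm_at i : tnorm (tat i) <= tw i.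
Proof. by apply: gauge_atom; [exact: tw_ge0|exact: tgen]. Qed.

Lemma tnorm_bound (q : V -> R) (C : R) : seminorm q -> 0 <= C ->
  (forall i, q (tat i) <= C * tw i) -> forall v, q v <= C * tnorm v.
Proof. move=> *; apply: gauge_bound => //; [exact: tw_ge0|exact: tgen]. Qed.

Definition ev (B : form) : V -> R^o := fun u => tev V u B.

Lemma ev_linear B : linear (ev B).
Proof. by move=> a u v; rewrite /ev linearP. Qed.

HB.instance Definition _ B := GRing.isLinear.Build R V R^o _ (ev B) (ev_linear B).

Lemma evZ B a u : ev B (a *: u) = a * ev B u.
Proof. exact: (linearZ_LR (ev B : {linear V -> R^o})). Qed.

Lemma ev_sum B (I : finType) (f : I -> V) : ev B (\sum_j f j) = \sum_j ev B (f j).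
Proof. exact: (linear_sum (ev B : {linear V -> R^o})). Qed.

Lemma functional_seminorm (f : {linear V -> R^o}) : seminorm (fun u => `|f u|).
Proof. exact: (@normr_linear_seminorm R R^o R^o). Qed.

Lemma ev_at B i : ev B (tat i) = B (ttup i). Proof. exact: tev_at. Qed.

Lemma ev_prod_norm (l : 'I_N -> {linear F -> R^o}) u :
  (forall s y, `|l s y| <= `|y|) -> `|ev (prod_form l) u| <= 1 * tnorm u.
Proof.
move=> l1; apply: (tnorm_bound (q := fun u => `|ev (prod_form l) u|)) => //.
  exact: functional_seminorm.
by move=> i; rewrite mul1r ev_at /= normr_prod ler_prod // => s _; rewrite normr_ge0 l1.
Qed.

Definition alt_term (p t : 'S_N.+1) : 'I_N -> {linear F -> R^o} :=
  fun s => coord X (inl (p (wid s), t (p (wid s)))).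

(** [B] as a functional on tensors, assembled from evaluations at product forms so that linearity
    comes from that of [ev]. *)
Definition alt_fun (u : V) : R^o :=
  K^-1 * \sum_(p : 'S_N.+1) \sum_(t : 'S_N.+1) (-1) ^+ t * ev (prod_form (alt_term p t)) u.

Lemma alt_fun_linear : linear alt_fun.
Proof.
move=> a u v; rewrite /alt_fun -[RHS]/(a * _ + _) mulrCA -mulrDr; congr (_ * _).
rewrite mulr_sumr -big_split; apply: eq_bigr => p _ /=.
rewrite mulr_sumr -big_split; apply: eq_bigr => t _ /=.
by rewrite linearP mulrDr; congr (_ + _); exact: mulrCA.
Qed.

HB.instance Definition _ := GRing.isLinear.Build R V R^o _ alt_fun alt_fun_linear.

Lemma alt_funZ a u : alt_fun (a *: u) = a * alt_fun u.
Proof. exact: (linearZ_LR (alt_fun : {linear V -> R^o})). Qed.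

Lemma alt_fun_sum (I : Type) (r : seq I) (f : I -> V) :
  alt_fun (\sum_(j <- r) f j) = \sum_(j <- r) alt_fun (f j).
Proof. exact: (linear_sum (alt_fun : {linear V -> R^o})). Qed.

Lemma alt_fun_at i : alt_fun (tat i) = altF X (ttup i).
Proof.
by congr (_ * _); apply: eq_bigr => p _; apply: eq_bigr => t _; rewrite ev_at.
Qed.

Lemma tat_scale i i' (c : 'I_N -> R) : (forall s, ttup i s = c s *: ttup i' s) ->
  tat i = (\prod_s c s) *: (tat i' : V).
Proof.
move=> ic; apply: tev_inj => B; transitivity ((\prod_s c s) * B (ttup i')).
  by rewrite tev_at -mform_scale; apply: mform_ext => s; rewrite ic.
by rewrite -[RHS]/(ev B _) evZ ev_at.
Qed.

Lemma tat_unit i : exists2 i', forall s, `|ttup i' s| <= 1 & tat i = tw i *: tat i'.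
Proof.
have [i' iE] := tunit_ind i; exists i' => [s|].
  rewrite iE normrZ normfV normr_id; have [->|n0] := eqVneq `|ttup i s| 0.
    by rewrite mulr0.
  by rewrite mulVf.
apply: tat_scale => s; rewrite iE scalerA.
have [n0|n0] := eqVneq `|ttup i s| 0; last by rewrite divff // scale1r.
by move/normr0_eq0: (n0) => ->; rewrite scaler0.
Qed.

Lemma alt_fun_norm u : `|alt_fun u| <= 1 * tnorm u.
Proof.
apply: (tnorm_bound (q := fun u => `|alt_fun u|)) => //.
  exact: (functional_seminorm alt_fun).
move=> i; have [i' i1 ->] := tat_unit i.
rewrite alt_funZ normrM (ger0_norm (tw_ge0 i)) mul1r ler_piMr ?tw_ge0 //.
by rewrite alt_fun_at altF_le1.
Qed.

Definition peakT (s : 'S_N.+1) M : V := tat (tcst V (peak X s M)).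

Lemma ev_peakT B s M : ev B (peakT s M) = B (fun=> peak X s M).
Proof. by rewrite ev_at; apply: mform_ext => i; rewrite tcstE. Qed.

Lemma tnorm_peakT s M : tnorm (peakT s M) <= (1 + M.+1%:R^-1) ^+ N.
Proof.
rewrite (le_trans (tnorm_at _)) // /tw (eq_bigr (fun=> `|peak X s M|)).
  by rewrite prodr_const card_ord lerXn2r ?nnegrE ?norm_peak ?addr_ge0 ?invr_ge0.
by move=> i _; rewrite tcstE.
Qed.

Lemma tnorm_peakT2 s M : tnorm (peakT s M) <= 2 ^+ N.
Proof.
rewrite (le_trans (tnorm_peakT s M)) // lerXn2r ?nnegrE ?addr_ge0 ?invr_ge0 //.
exact: (wt_le2 R (inl (s, M) : idx N)).
Qed.

Lemma alt_fun_peakT s M : alt_fun (peakT s M) = (-1) ^+ s.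
Proof.
rewrite alt_fun_at -(altF_peak X s (fun=> M)).
by congr (altF X _); apply/funext => i; rewrite tcstE.
Qed.

Definition cutT M : {linear V -> V} := tmap V (cut X M).

Lemma cutT_at M i i' : (forall s, ttup i' s = cut X M (ttup i s)) ->
  cutT M (tat i) = tat i'.
Proof.
move=> iE; apply: tev_inj => B; rewrite tmapE !tev_at /=.
by apply: mform_ext => s; rewrite iE.
Qed.

Lemma tnorm_cutT M u : tnorm (cutT M u) <= 2 ^+ N * tnorm u.
Proof.
have [hD hZ] := tnorm_seminorm.
apply: (tnorm_bound (q := fun u => tnorm (cutT M u))); last 1 first.
- move=> i; have [i' iE] := tmap_ind (cut X M) i.
  rewrite (cutT_at iE) (le_trans (tnorm_at _)) //.
  have -> : 2 ^+ N = \prod_(s < N) 2 :> R by rewrite prodr_const card_ord.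
  rewrite -big_split /=.
  by apply: ler_prod => s _; rewrite normr_ge0 iE cut_norm.
- by split=> [u1 v|a v]; rewrite ?linearD ?linearZ ?hD ?hZ.
- by rewrite exprn_ge0.
Qed.

(** When all factors have norm at most 1, [altF_near_max] puts the cut factors near multiples of one
    p(s, M), [tline_ind] moves them onto that line, and [tcont] bounds the price in the tensor norm.
    The general case follows by scaling with [tw i]. *)
Lemma near_peak M : exists2 C : R, 0 < C & forall (i : tind V) (e : R), 0 < e ->
  exists (s : 'S_N.+1) (m : R),
    tnorm (cutT M (tat i) - m *: peakT s M)
      <= C * (tw i - `|alt_fun (tat i)|) + e * tw i.
Proof.
have [C C0 hC] := tcont V; have g0 := gap_gt0 N R M.
exists (C * (4 / gap N R M)) => [|i e e0]; first by rewrite mulr_gt0 // divr_gt0.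
have [i' i1 ->] := tat_unit i.
have [s [c [c1 cy]]] := altF_near_max X N2 M i1 (divr_gt0 e0 C0).
have [i2 i2E] := tmap_ind (cut X M) i'.
have {}cy r : `|ttup i2 r - c r *: peak X s M|
    <= 4 * ((1 - `|altF X (ttup i')|) / gap N R M) + e / C by rewrite i2E.
have [i3 [d [d1 i3E i23]]] := tline_ind c1 cy.
exists s, (tw i * \prod_r d r).
have i3P : tat i3 = (\prod_r d r) *: peakT s M.
  by apply: tat_scale => r; rewrite i3E tcstE.
rewrite linearZ -scalerA -scalerBr (seminormZ tnorm_seminorm) (ger0_norm (tw_ge0 i)).
rewrite -i3P (cutT_at i2E).
have h : tnorm (tat i2 - tat i3) <= C * (4 * ((1 - `|altF X (ttup i')|) / gap N R M) + e / C).
  apply: hC => // r.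
    by rewrite i2E (le_trans (cut_norm _ _ _)) // ler_piMr.
  rewrite i3E normrZ; have := norm_peak2 X s M; have := d1 r.
  by have := normr_ge0 (d r); have := normr_ge0 (peak X s M); nra.
rewrite (le_trans (ler_wpM2l (tw_ge0 i) h)) // alt_funZ alt_fun_at [`|tw i * _|]normrM.
rewrite (ger0_norm (tw_ge0 i)) le_eqVlt; apply/orP; left; apply/eqP.
by field; rewrite !gt_eqF.
Qed.

(** By the triangle inequality for [alt_fun], the weighted defects of the terms add up to at most
    the defect of the whole combination. The coefficients [m s] collect the terms near the same p(s,
    M). *)
Lemma near_peaks M : exists2 C : R, 0 < C & forall (l : seq (R * tind V)) (e : R), 0 < e ->
  exists m : 'S_N.+1 -> R,
    tnorm (cutT M (atomic (@tat _ _ _ V) l) - \sum_s m s *: peakT s M)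
      <= C * (mass tw l - `|alt_fun (atomic (@tat _ _ _ V) l)|) + e * mass tw l.
Proof.
have [C C0 hC] := near_peak M; exists C => // l e e0.
suff [m hm] : exists m : 'S_N.+1 -> R,
    tnorm (cutT M (atomic (@tat _ _ _ V) l) - \sum_s m s *: peakT s M)
      <= \sum_(x <- l) `|x.1| * (C * (tw x.2 - `|alt_fun (tat x.2)|) + e * tw x.2).
  exists m; rewrite (le_trans hm) //.
  have -> : \sum_(x <- l) `|x.1| * (C * (tw x.2 - `|alt_fun (tat x.2)|) + e * tw x.2) =
      C * (mass tw l - \sum_(x <- l) `|x.1| * `|alt_fun (tat x.2)|) + e * mass tw l.
    rewrite /mass -sumrB !mulr_sumr -big_split; apply: eq_bigr => x _ /=; ring.
  rewrite lerD2r ler_wpM2l ?(ltW C0) // lerD2l lerN2 /atomic alt_fun_sum.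
  rewrite (le_trans (ler_norm_sum _ _ _)) // ler_sum // => x _.
  by rewrite alt_funZ normrM.
elim: l => [|[a i] l [m hm]].
  exists (fun=> 0); rewrite /atomic !big_nil linear0 big1 => [|s _].
    by rewrite subrr (seminorm0 tnorm_seminorm).
  by rewrite scale0r.
have [s [b hb]] := hC i e e0.
exists (fun t => m t + (if t == s then a * b else 0)).
rewrite /atomic !big_cons -/(atomic _ _) /= linearD linearZ.
have -> : \sum_t (m t + (if t == s then a * b else 0)) *: peakT t M =
    a *: (b *: peakT s M) + \sum_t m t *: peakT t M.
  under eq_bigr do rewrite scalerDl; rewrite big_split /= addrC; congr (_ + _).
  rewrite (bigD1 s) //= eqxx scalerA big1 ?addr0 // => t /negbTE ->.
  by rewrite scale0r.
rewrite opprD addrACA -scalerBr (le_trans (seminormD tnorm_seminorm _ _)) //.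
by rewrite lerD // (seminormZ tnorm_seminorm) ler_wpM2l.
Qed.

Definition witness : V := \sum_(s : 'S_N.+1) ((-1) ^+ s / K) *: peakT s 0.

Lemma witnessE M : witness = \sum_(s : 'S_N.+1) ((-1) ^+ s / K) *: peakT s M.
Proof.
apply: tev_inj => B; rewrite -[LHS]/(ev B _) -[RHS]/(ev B _) !ev_sum.
have h m : \sum_(s : 'S_N.+1) ev B (((-1) ^+ s / K) *: peakT s m) =
    K^-1 * \sum_(s : 'S_N.+1) (-1) ^+ s * B (fun=> peak X s m).
  rewrite mulr_sumr; apply: eq_bigr => s _.
  by rewrite evZ ev_peakT mulrAC mulrC.
by rewrite !h (sum_sign_peak X B 0 M).
Qed.

Lemma tnorm_witness M : tnorm witness <= (1 + M.+1%:R^-1) ^+ N.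
Proof.
rewrite (witnessE M) (le_trans (seminorm_sum tnorm_seminorm _ _ _)) //.
have K0 := K_gt0 N R.
apply: (@le_trans _ _ (\sum_(s : 'S_N.+1) K^-1 * (1 + M.+1%:R^-1) ^+ N)).
  apply: ler_sum => s _; rewrite (seminormZ tnorm_seminorm) normrM normr_sign mul1r.
  rewrite [`|K^-1|]ger0_norm ?invr_ge0 ?ler0n //.
  by apply: ler_wpM2l; [rewrite invr_ge0 ler0n|exact: tnorm_peakT].
by rewrite sumr_const -[X in X <= _]mulr_natl mulrA divff ?mul1r // gt_eqF.
Qed.

Lemma tnorm_witness1 : tnorm witness <= 1.
Proof.
have h : (fun M => (1 + (M.+1%:R : R)^-1) ^+ N) @ \oo --> (1 + 0 : R) ^+ N.
  apply: (@continuous_cvg _ _ _ _ _ _ (fun x : R => x ^+ N)).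
    exact: exprn_continuous.
  apply: cvgD; first exact: cvg_cst.
  exact: cvg_harmonic.
rewrite -(expr1n R N) -[X in _ <= X ^+ _]addr0.
apply: ler_cvg_to (cvg_cst _) h _.
by apply: nearW => M; exact: tnorm_witness.
Qed.

Lemma alt_fun_witness : alt_fun witness = 1.
Proof.
rewrite alt_fun_sum (eq_bigr (fun=> K^-1)) => [|s _].
  by rewrite sumr_const -[LHS]mulr_natl divff // gt_eqF ?K_gt0.
by rewrite alt_funZ alt_fun_peakT mulrAC -signr_addb addbb mul1r.
Qed.

End Model.

(** * Exposedness and non-elementarity in the completion *)

Section Exposed.
Variables (R : realType) (N : nat) (F : completeNormedModType R) (X : factor_space N F).
Variable (V : tensor_model N F).
Hypothesis N2 : (2 <= N)%N.
Variables (T : completeNormedModType R) (iota : {linear V -> T}).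
Hypothesis iotaP : is_completion (@tnorm _ _ _ V) iota.

Local Notation K := (#|{: 'S_N.+1}|%:R : R).

Lemma cut_cvg (y : F) (e : R) : 0 < e ->
  exists M0, forall M, (M0 <= M)%N -> `|cut X M y - y| <= e.
Proof.
move=> e0; have [x xy] := completion_approx (embP X) y (divr_gt0 e0 (ltr0n R 3)).
have [M0 hM0] := trunc_id x; exists M0 => M MM0.
have := ler_distD (emb X x) (cut X M y) y.
rewrite -{1}(hM0 M MM0) -cut_emb -linearB [`|emb X x - y|]distrC.
by have := cut_norm X M (y - emb X x); lra.
Qed.

Lemma cutT_cvg (u : V) (e : R) : 0 < e ->
  exists M0, forall M, (M0 <= M)%N -> tnorm (cutT X V M u - u) <= e.
Proof.
move: u e; pose P (u : V) := forall e : R, 0 < e ->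
  exists M0, forall M, (M0 <= M)%N -> tnorm (cutT X V M u - u) <= e.
have hs := tnorm_seminorm V.
have PD u v : P u -> P v -> P (u + v).
  move=> Pu Pv e e0; have [M1 h1] := Pu _ (divr_gt0 e0 (ltr0n R 2)).
  have [M2 h2] := Pv _ (divr_gt0 e0 (ltr0n R 2)).
  exists (maxn M1 M2) => M; rewrite geq_max => /andP[/h1 g1 /h2 g2].
  by rewrite linearD opprD addrACA (le_trans (seminormD hs _ _)) // [leRHS]splitr lerD.
have PZ c u : P u -> P (c *: u).
  move=> Pu e e0; have d0 : 0 < e / (`|c| + 1) by rewrite divr_gt0 // ltr_wpDl.
  have [M1 h1] := Pu _ d0; exists M1 => M /h1.
  rewrite ler_pdivlMr ?ltr_wpDl // linearZ -scalerBr (seminormZ hs); apply: le_trans.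
  by rewrite mulrC ler_wpM2l ?(seminorm_ge0 hs) // lerDl.
have Pat i : P (tat i).
  have [i' i1 ->] := tat_unit i; apply: PZ => e e0; have [C C0 hC] := tcont V.
  have /choice[M0 hM0] s := cut_cvg (ttup i' s) (divr_gt0 e0 C0).
  exists (\max_s M0 s) => M MM0; have [i2 i2E] := tmap_ind (cut X M) i'.
  rewrite (cutT_at i2E); have -> : e = C * (e / C) by rewrite mulrCA divff ?mulr1 // gt_eqF.
  apply: hC => s.
  - by rewrite i2E (le_trans (cut_norm _ _ _)) // ler_piMr.
  - by rewrite (le_trans (i1 s)) // ler1n.
  - by rewrite i2E hM0 // (leq_trans (leq_bigmax s)).
move=> u; rewrite -/(P u); have [n [c [i ->]]] := tgen u.
elim/big_ind: _ => [e e0||j _]; [|exact: PD|exact: PZ].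
by exists 0%N => M _; rewrite linear0 subr0 (seminorm0 hs) ltW.
Qed.

Definition unit_functional (l : 'I_N -> {linear F -> R^o}) :=
  forall s y, `|l s y| <= `|y|.

Lemma ev_extend (l : 'I_N -> {linear F -> R^o}) : unit_functional l ->
  exists g : {linear T -> R^o},
    (forall u, g (iota u) = ev (prod_form l) u) /\ (forall t, `|g t| <= 1 * `|t|).
Proof.
by move=> l1; apply: (completion_extend iotaP (L := ev (prod_form l))) => // u;
  apply: ev_prod_norm.
Qed.

(** The product of these N entries reads off the coefficient of p(s, M)^{⊗N} for every M, the row
    [ord_max] being determined by the others. Matrix entries are unaffected by cutting. *)
Definition chi_form (s : 'S_N.+1) : 'I_N -> {linear F -> R^o} :=
  fun r => coord X (inl (wid r, s (wid r))).

Lemma chi_form_unit s : unit_functional (chi_form s).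
Proof. by move=> r y; exact: coord_norm. Qed.

Lemma chi_peak (s t : 'S_N.+1) M :
  ev (prod_form (chi_form s)) (peakT X V t M) = (s == t)%:R.
Proof.
rewrite ev_peakT /= (eq_bigr (fun r => (t (wid r) == s (wid r))%:R)) => [|r _]; last first.
  by rewrite coord_peak.
have [->|st] := eqVneq s t; first by rewrite big1 // => r _; rewrite eqxx.
have [r /negbTE rE] : exists r, t (wid r) != s (wid r).
  apply/not_existsP => h; move/eqP: st; apply; apply: (@perm_eq_off1 _ ord_max) => x.
  by move=> /widP[r ->]; have /negP := h r; rewrite negbK => /eqP.
by rewrite (bigD1 r) //= rE mul0r.
Qed.

Lemma chi_cutT s M u :
  ev (prod_form (chi_form s)) (cutT X V M u) = ev (prod_form (chi_form s)) u.
Proof.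
rewrite /ev tmapE -!/(ev _ _); have [n [c [i ->]]] := tgen u.
rewrite !ev_sum; apply: eq_bigr => j _; rewrite !evZ !ev_at /=; congr (_ * _).
by apply: eq_bigr => r _; rewrite coord_cut.
Qed.

(** Slot r reads the indicator at k instead of row [wid r]. This detects whether the height reaches
    k; with two rows unread, it cannot separate t from its composition with the transposition of
    [wid r] and [ord_max]. *)
Definition psi_form (t : 'S_N.+1) (r : 'I_N) (k : nat) : 'I_N -> {linear F -> R^o} :=
  fun q => if q == r then coord X (inr k) else coord X (inl (wid q, t (wid q))).

Lemma psi_form_unit t r k : unit_functional (psi_form t r k).
Proof. by move=> q y; rewrite /psi_form; case: ifP => _; exact: coord_norm. Qed.

Lemma psi_peak t r k s M : ev (prod_form (psi_form t r k)) (peakT X V s M) =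
  ((k <= M)%N && ((s == t) || (s == tperm (wid r) ord_max * t)%g))%:R.
Proof.
rewrite ev_peakT /= (bigD1 r) //= {1}/psi_form eqxx coord_peak /=.
rewrite (eq_bigr (fun q => (s (wid q) == t (wid q))%:R)) => [|q qr]; last first.
  by rewrite /psi_form (negbTE qr) coord_peak.
case: leqP => _; last by rewrite mul0r.
rewrite mul1r /=; have rm := wid_max r.
have [/orP[/eqP->|/eqP->]|] := boolP (_ || _).
- by rewrite big1 // => q _; rewrite eqxx.
- rewrite big1 // => q qr; rewrite permM tpermD ?eqxx //.
    by rewrite (inj_eq (@wid_inj _)) eq_sym.
  by rewrite eq_sym wid_max.
rewrite negb_or => /andP[st st'].
have [q qr /negbTE qE] : exists2 q, q != r & s (wid q) != t (wid q).
  apply/not_exists2P => h.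
  have {}h x : x != wid r -> x != ord_max -> s x = t x.
    move=> xr /widP[q xq]; case: (h q); last by move=> /negP; rewrite negbK xq => /eqP.
    by move=> /negP; rewrite negbK => /eqP qr; rewrite xq qr eqxx in xr.
  have [sr|sr] := eqVneq (s (wid r)) (t (wid r)).
    move/eqP: st; apply; apply: (@perm_eq_off1 _ ord_max) => x xm.
    by have [->//|xr] := eqVneq x (wid r); exact: h.
  have srm : s (wid r) = t ord_max.
    have [x xE] : exists x, t x = s (wid r) by exists ((t^-1)%g (s (wid r))); rewrite permKV.
    have [xr|xr] := eqVneq x (wid r); first by rewrite -xE xr eqxx in sr.
    have [xm|xm] := eqVneq x ord_max; first by rewrite -xE xm.
    by move: (h x xr xm); rewrite xE => /perm_inj/eqP; rewrite (negbTE xr).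
  move/eqP: st'; apply; apply: (@perm_eq_off1 _ ord_max) => x xm.
  rewrite permM; have [->|xr] := eqVneq x (wid r); first by rewrite tpermL.
  by rewrite tpermD ?h // eq_sym.
by rewrite (bigD1 q) //= qE mul0r.
Qed.

Lemma exposed_witness : exposed_point (unit_ball (E := T)) (iota (witness X V)).
Proof.
have hs := tnorm_seminorm V; have K0 := K_gt0 N R.
have w1 : `|iota (witness X V)| <= 1 by rewrite iotaP.1 tnorm_witness1.
have [f [fE f1]] : exists f : {linear T -> R^o},
    (forall u, f (iota u) = alt_fun X u) /\ (forall t, `|f t| <= 1 * `|t|).
  by apply: (completion_extend iotaP (L := @alt_fun _ _ _ X V)) => // u; apply: alt_fun_norm.
have fw : f (iota (witness X V)) = 1 by rewrite fE alt_fun_witness.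
split=> //; exists f; split; first exact: lipschitz_linear_continuous f1.
move=> t t1 tw; rewrite fw lt_neqAle; apply/andP; split; last first.
  by have := f1 t; have := ler_norm (f t); move: t1; rewrite /unit_ball /=; lra.
apply/eqP => ft; apply: tw.
have /choice[c cP] M : exists g : {linear T -> T},
    (forall u, g (iota u) = iota (cutT X V M u)) /\ (forall t, `|g t| <= 2 ^+ N * `|t|).
  apply: (completion_extend iotaP (L := iota \o cutT X V M)) => [|u].
    by rewrite exprn_ge0.
  by rewrite /= iotaP.1 tnorm_cutT.
have cE M u : c M (iota u) = iota (cutT X V M u) by have [] := cP M.
have c1 M z : `|c M z| <= 2 ^+ N * `|z| by have [] := cP M.
have /choice[chi chiP] s := ev_extend (@chi_form_unit s).
have chiE s u : chi s (iota u) = ev (prod_form (chi_form s)) u by have [] := chiP s.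
have chi1 s z : `|chi s z| <= 1 * `|z| by have [] := chiP s.
have chi_c s M z : chi s (c M z) = chi s z.
  apply: (completion_ext iotaP (f := chi s \o c M) (g := chi s) (C := 2 ^+ N)).
  - by move=> z' /=; rewrite (le_trans (chi1 _ _)) // mul1r.
  - move=> z'; rewrite (le_trans (chi1 _ _)) // ler_wpM2r // exprn_ege1 //.
    by rewrite ler1n.
  - by move=> u /=; rewrite cE !chiE chi_cutT.
(* Approximants u of t with a representation of mass at most 1 + 2 d and |B(u)| >= 1 - d have defect
   at most 3 d, so [near_peaks] brings the cut of t arbitrarily close to the span of the p(s,
   M)^{⊗N}. *)
have cut_peaks M : c M t = \sum_s chi s t *: iota (peakT X V s M).
  have near e : 0 < e -> exists m : 'S_N.+1 -> R,
      `|c M t - iota (\sum_s m s *: peakT X V s M)| <= e.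
    move=> e0; have [C C0 hC] := near_peaks X V N2 M.
    have p0 : 0 < 2 ^+ N :> R by rewrite exprn_gt0.
    have b0 : 0 < 2 ^+ N + 3 * C + 3 + e by lra.
    (* The denominator covers 2^N d for passing from t to u, 3 C d for the defect and d (1 + 2 d) <=
       3 d; the extra e ensures d <= 1. *)
    pose d := e / (2 ^+ N + 3 * C + 3 + e); have d0 : 0 < d by rewrite divr_gt0.
    have de : d * (2 ^+ N + 3 * C + 3 + e) = e by rewrite /d mulfVK // gt_eqF.
    have d1 : d <= 1.
      by rewrite /d ler_pdivrMr // mul1r; lra.
    have [u tu] := completion_approx iotaP t d0.
    have [l uE lu] := gauge_approx (@tw_ge0 _ _ _ V) (@tgen _ _ _ V) u d0.
    have [m hm] := hC l d d0; rewrite -uE in hm; exists m.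
    have u1 : tnorm u <= 1 + d.
      rewrite -iotaP.1; have := ler_distD t (iota u) 0; rewrite !subr0 distrC.
      by move: t1; rewrite /unit_ball /=; lra.
    have fu : 1 - d <= `|alt_fun X u|.
      rewrite -fE; have := f1 (t - iota u); rewrite linearB /= ft => h.
      have := ler_distD (f (iota u)) 1 0; rewrite !subr0 normr1.
      by move: tu h; lra.
    have h1 : `|c M t - c M (iota u)| <= 2 ^+ N * d.
      by rewrite -linearB (le_trans (c1 _ _)) // ler_wpM2l ?exprn_ge0 // ltW.
    have lu' : mass (@tw _ _ _ V) l <= 1 + 2 * d.
      by move: lu; rewrite -/(tnorm u); lra.
    have h2 : `|c M (iota u) - iota (\sum_s m s *: peakT X V s M)| <= C * (3 * d) + d * (1 + 2 * d).
      rewrite cE -linearB iotaP.1 (le_trans hm) // lerD // ler_wpM2l ?ltW //; lra.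
    have := ler_distD (c M (iota u)) (c M t) (iota (\sum_s m s *: peakT X V s M)).
    by nra.
  apply/eqP; rewrite -subr_eq0 -normr_le0; apply/ler_addgt0Pr => e e0; rewrite add0r.
  have b0 : 0 < 1 + K * 2 ^+ N by rewrite addr_gt0 // mulr_gt0 // exprn_gt0.
  have [m hm] := near _ (divr_gt0 e0 b0); set d := e / _ in hm.
  (* [chi s] recovers [m s] from the approximation and is unchanged by cutting, so the approximate
     coefficients may be replaced by those of t. *)
  have chim s : `|m s - chi s t| <= d.
    rewrite distrC -(chi_c s M t); have -> : m s = chi s (iota (\sum_t m t *: peakT X V t M)).
      rewrite chiE ev_sum (bigD1 s) //= big1 ?addr0 => [|q qs].
        by rewrite evZ chi_peak eqxx mulr1.
      by rewrite evZ chi_peak eq_sym (negbTE qs) mulr0.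
    by rewrite -linearB (le_trans (chi1 _ _)) // mul1r.
  have h2 : `|iota (\sum_s m s *: peakT X V s M) - \sum_s chi s t *: iota (peakT X V s M)|
      <= K * (d * 2 ^+ N).
    rewrite linear_sum -sumrB (le_trans (ler_norm_sum _ _ _)) //.
    rewrite mulr_natl -sumr_const; apply: ler_sum => s _.
    by rewrite linearZ -scalerBl normrZ iotaP.1 ler_pM // ?tnorm_peakT2 ?(seminorm_ge0 hs).
  rewrite (le_trans (ler_distD (iota (\sum_s m s *: peakT X V s M)) _ _)) //.
  have -> : e = d + K * (d * 2 ^+ N) by rewrite /d; field; rewrite gt_eqF.
  exact: lerD.
have c_cvg e : 0 < e -> exists M0, forall M, (M0 <= M)%N -> `|c M t - t| <= e.
  move=> e0; have b0 : 0 < 2 ^+ N + 2 + e :> R by rewrite !addr_gt0 ?exprn_gt0.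
  have d0 := divr_gt0 e0 b0; have [u tu] := completion_approx iotaP t d0.
  have [M0 hM0] := cutT_cvg u d0; exists M0 => M MM0.
  set d := e / _ in d0 tu hM0.
  have de : d * (2 ^+ N + 2 + e) = e by rewrite /d mulfVK // gt_eqF.
  have h1 : `|c M t - c M (iota u)| <= 2 ^+ N * d.
    by rewrite -linearB (le_trans (c1 _ _)) // ler_wpM2l ?exprn_ge0 // ltW.
  have h2 : `|c M (iota u) - iota u| <= d by rewrite cE -linearB iotaP.1 hM0.
  have h3 := ler_distD (c M (iota u)) (c M t) t.
  have h4 := ler_distD (iota u) (c M (iota u)) t.
  move: h4; rewrite [`|iota u - t|]distrC; move: tu de h1 h2 h3; nra.
(* [psi] with k = M + 1 vanishes on the cut at M, and on the cut at M + 1 it returns the sum of the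
   two coefficients. Both cuts are within e / 2 of t, so this sum is at most e in absolute value. *)
have flip r s : chi (tperm (wid r) ord_max * s)%g t = - chi s t.
  apply/eqP; rewrite -subr_eq0 opprK addrC -normr_le0.
  apply/ler_addgt0Pr => e e0; rewrite add0r.
  have [M hM] := c_cvg _ (divr_gt0 e0 (ltr0n R 2)).
  have [psi [psiE psi1]] := ev_extend (psi_form_unit s r M.+1).
  have psi_c M' : psi (c M' t) = \sum_q chi q t *
      ((M.+1 <= M')%N && ((q == s) || (q == tperm (wid r) ord_max * s)%g))%:R.
    rewrite cut_peaks linear_sum; apply: eq_bigr => q _.
    by rewrite linearZ /= psiE psi_peak.
  have pM : psi (c M t) = 0.
    by rewrite psi_c big1 // => q _; rewrite ltnn mulr0.
  have ss : (tperm (wid r) ord_max * s)%g != s.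
    rewrite -[X in _ != X]mul1g (inj_eq (mulIg s)); apply/eqP => /permP/(_ (wid r)).
    by rewrite tpermL perm1 => /esym/eqP; rewrite (negbTE (wid_max r)).
  have pM1 : psi (c M.+1 t) = chi s t + chi (tperm (wid r) ord_max * s)%g t.
    rewrite psi_c leqnn (bigD1 s) //= eqxx mulr1; congr (_ + _).
    rewrite (bigD1 (tperm (wid r) ord_max * s)%g) //= eqxx orbT mulr1 big1 ?addr0 // => q /andP[/negbTE -> /negbTE ->].
    by rewrite mulr0.
  rewrite -pM1 -[psi _]subr0 -pM -linearB (le_trans (psi1 _)) // mul1r.
  have := ler_distD t (c M.+1 t) (c M t); have := hM _ (leqnSn M); have := hM _ (leqnn M).
  by rewrite [`|c M t - t|]distrC; lra.
have chi_sign := perm_sign_unique flip.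
have f_c M : f (c M t) = K * chi 1%g t.
  rewrite cut_peaks linear_sum mulr_natl -sumr_const; apply: eq_bigr => s _.
  by rewrite linearZ /= fE alt_fun_peakT chi_sign -[_ *: _]/(_ * _) mulrAC -signr_addb addbb mul1r.
(* The condition B(t) = 1 fixes the remaining scalar, as the cuts converge to t and [f] takes the
   same value on all of them. *)
have chi1E : chi 1%g t = K^-1.
  suff h : 1 = K * chi 1%g t.
    by have := congr1 (fun z => K^-1 * z) h; rewrite mulr1 mulKf ?gt_eqF // => <-.
  apply/eqP; rewrite -subr_eq0 -normr_le0; apply/ler_addgt0Pr => e e0; rewrite add0r.
  have [M hM] := c_cvg _ e0; rewrite -(f_c M) -ft -linearB (le_trans (f1 _)) // mul1r.
  by rewrite distrC hM.
have c_w M : c M t = iota (witness X V).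
  rewrite cut_peaks (witnessE X V M) linear_sum; apply: eq_bigr => s _.
  by rewrite linearZ chi_sign chi1E.
apply/eqP; rewrite -subr_eq0 -normr_le0; apply/ler_addgt0Pr => e e0; rewrite add0r.
by have [M hM] := c_cvg _ e0; rewrite -(c_w M) distrC hM.
Qed.

(** On an elementary tensor, product forms factor over the slots. The coefficients of the identity
    and of the transposition of [wid i0] and [wid i1] are nonzero, so [mix], which takes slot i1
    from the latter and the other slots from the former, would be nonzero too. But [mix] reads the
    same column in two rows, which no permutation matrix allows, so it vanishes on the witness. The
    scalar a covers both signs in the symmetric case. *)
Lemma witness_not_elementary (a : R) (i : tind V) : iota (witness X V) <> a *: iota (tat i).
Proof.
move=> wi; have evE (l : 'I_N -> {linear F -> R^o}) : unit_functional l ->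
    ev (prod_form l) (witness X V) = a * \prod_s l s (ttup i s).
  move=> /ev_extend[g [gE _]]; rewrite -gE wi -linearZ gE evZ ev_at //.
have chi_w s : ev (prod_form (chi_form s)) (witness X V) != 0.
  rewrite ev_sum (bigD1 s) //= big1 ?addr0 => [|q qs].
    by rewrite evZ chi_peak eqxx mulr1 mulf_neq0 ?signr_eq0 // invr_neq0 // gt_eqF ?K_gt0.
  by rewrite evZ chi_peak eq_sym (negbTE qs) mulr0.
pose i0 : 'I_N := Ordinal (ltnW N2); pose i1 : 'I_N := Ordinal N2.
pose mix (q : 'I_N) := coord X (inl (wid q, if q == i1 then wid i0 else wid q)).
have mix_w : ev (prod_form mix) (witness X V) = 0.
  rewrite ev_sum big1 // => s _; rewrite evZ ev_peakT /= (bigD1 i0) //= (bigD1 i1) //=.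
  rewrite /mix /= !coord_peak /=.
  case: eqP => [s0|_]; last by rewrite mul0r mulr0.
  case: eqP => [s1|_]; last by rewrite mul0r !mulr0.
  by have := etrans s0 (esym s1) => /perm_inj/wid_inj.
have := chi_w 1%g; have := chi_w (tperm (wid i0) (wid i1)).
rewrite !evE; try exact: chi_form_unit.
rewrite !mulf_eq0 !negb_or => /andP[_ /prodf_neq0 h1] /andP[a0 /prodf_neq0 h0].
move/eqP: mix_w; rewrite evE; last by move=> q y; exact: coord_norm.
rewrite mulf_eq0 (negbTE a0) /=; apply/negP/prodf_neq0 => q _.
rewrite /mix; case: (eqVneq q i1) => [->|_].
  by have := h1 i1 isT; rewrite /chi_form tpermR.
by have := h0 q isT; rewrite /chi_form perm1.
Qed.

End Exposed.

(** * Full and symmetric tensor products *)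

Section FullTensor.
Variables (R : realType) (N : nat) (F : completeNormedModType R).
Hypothesis N2 : (2 <= N)%N.

Local Notation form := (multilinear_form (fun _ : 'I_N => F)).
Local Notation full := (tensor (fun _ : 'I_N => F)).
Local Notation raw := (form -> R^o).
Local Notation elem := (@eval_form R N (fun _ => F)).

(** Tensors being functionals on forms, A acts on them by pulling forms back; on elementary tensors
    this applies A to every factor. *)
Definition raw_pull (A : {linear F -> F}) : raw -> raw := fun w B => w (pull_form A B).

Lemma raw_pull_linear A : linear (raw_pull A). Proof. by []. Qed.

HB.instance Definition _ A := GRing.isLinear.Build R raw raw _
  (raw_pull A) (raw_pull_linear A).

Lemma raw_pull_span A w : range elem w -> raw_pull A w \in in_span (range elem).
Proof. by move=> [x _ <-]; apply: in_span_gen; exists (fun s => A (x s)). Qed.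

Definition full_map (A : {linear F -> F}) : {linear full -> full} :=
  span_map (@raw_pull_span A).

Definition full_ev : {linear full -> raw} := \val.

Lemma full_ev_at (x : 'I_N -> F) B : full_ev (pure_tensor x) B = B x.
Proof. by []. Qed.

Lemma full_ev_inj (u v : full) : (forall B, full_ev u B = full_ev v B) -> u = v.
Proof. by move=> uv; apply: val_inj; apply/funext => B; exact: uv. Qed.

Definition pureF (x : 'I_N -> F) : full := pure_tensor x.

Lemma full_gen (u : full) : exists (n : nat) (c : 'I_n -> R) (i : 'I_n -> 'I_N -> F),
  u = \sum_(j < n) c j *: pureF (i j).
Proof. exact: span_of_gen. Qed.

Lemma full_ev_sum (I : finType) (f : I -> full) B :
  full_ev (\sum_j f j) B = \sum_j full_ev (f j) B.
Proof. by rewrite linear_sum; elim/big_ind2: _ => // x a y b <- <-. Qed.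

Definition full_weight (x : 'I_N -> F) : R := \prod_s `|x s|.

Lemma full_weight_ge0 x : 0 <= full_weight x. Proof. exact: prodr_ge0. Qed.

(** One factor is exchanged at a time: N terms, each with one factor of norm at most h and N - 1
    factors of norm at most 2. *)
Lemma full_cont : exists2 C : R, 0 < C & forall (x y : 'I_N -> F) h,
    (forall s, `|x s| <= 2) -> (forall s, `|y s| <= 2) ->
    (forall s, `|x s - y s| <= h) ->
  gauge pureF full_weight (pureF x - pureF y) <= C * h.
Proof.
have hs := gauge_seminorm full_weight_ge0 full_gen.
exists (N%:R * 2 ^+ N) => [|x y h x2 y2 xy].
  by rewrite mulr_gt0 ?exprn_gt0 // ltr0n ltnW.
have h0 : 0 <= h := le_trans (normr_ge0 _) (xy (Ordinal (ltnW N2))).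
have -> : pureF x - pureF y =
    \sum_(k < N) pureF (dfwith (hybrid k x y) k (x k - y k)).
  apply: full_ev_inj => B; rewrite full_ev_sum linearB.
  exact: mform_telescope.
rewrite (le_trans (seminorm_sum hs _ _ _)) // -mulrA mulr_natl.
rewrite -[X in _ *+ X]card_ord -sumr_const; apply: ler_sum => k _.
rewrite (le_trans (gauge_atom full_weight_ge0 full_gen _)) //.
rewrite /full_weight (bigD1 k) //= dfwithE eqxx mulrC.
apply: ler_pM => //; first exact: prodr_ge0.
apply: (@le_trans _ _ (\prod_(s < N | s != k) 2)).
  apply: ler_prod => s sk; rewrite normr_ge0 dfwithE (negbTE sk) /hybrid /=.
  by case: ifP => _; [exact: y2|exact: x2].
rewrite prodr_const ler_weXn2l ?ler1n //.
by rewrite (leq_trans (max_card _)) ?card_ord.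
Qed.

Definition full_model : tensor_model N F.
Proof.
apply: (@TensorModel R N F full ('I_N -> F) id pureF full_ev full_ev_at full_ev_inj
  full_gen full_map _ _ _ (fun x _ => x)).
- by [].
- by move=> A x; exists (fun s => A (x s)).
- by move=> x; exists (fun s => `|x s|^-1 *: x s).
- by [].
- by move=> i x c h c1 hc; exists (fun s => c s *: x), c.
- exact: full_cont.
Defined.

(** [proj_norm] has no scalar coefficients; they are absorbed into the factor of slot i0. *)
Lemma full_normE (u : full) : proj_norm u = gauge pureF full_weight u.
Proof.
congr inf; apply/seteqP; split=> s [n].
  move=> [x [-> ->]]; exists n, (fun=> 1), x; split.
    by apply: eq_bigr => j _; rewrite scale1r.
  by apply: eq_bigr => j _; rewrite normr1 mul1r.
move=> [c [x [-> ->]]]; pose i0 : 'I_N := Ordinal (ltnW N2).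
pose d j (s : 'I_N) := if s == i0 then c j else 1.
have dE j : \prod_s d j s = c j.
  rewrite (bigD1 i0) //= /d eqxx big1 ?mulr1 // => q /negbTE -> //.
exists n, (fun j q => d j q *: x j q); split; apply: eq_bigr => j _.
  by rewrite -[in LHS](dE j); apply/esym; apply: (@tat_scale _ _ _ full_model).
under [RHS]eq_bigr do rewrite normrZ.
by rewrite big_split /= -normr_prod dE.
Qed.

End FullTensor.

Arguments full_map {R N F} A.

Lemma horner_lipschitz0 (R : realType) (p : {poly R}) : exists2 D : R, 0 <= D &
  forall s, 0 <= s <= 1 -> `|p.[s] - p.[0]| <= D * s.
Proof.
exists (\sum_(i < size p) `|p`_i|) => [|s /andP[s0 s1]]; first exact: sumr_ge0.
rewrite !horner_coef -sumrB (le_trans (ler_norm_sum _ _ _)) // mulr_suml.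
apply: ler_sum => i _; rewrite -mulrBr normrM ler_wpM2l // expr0n.
case: (val i) => [|k] /=; first by rewrite subrr normr0.
by rewrite subr0 ger0_norm ?exprn_ge0 // exprS ler_piMr // exprn_ile1.
Qed.

Section SymmetricTensor.
Variables (R : realType) (N : nat) (F : completeNormedModType R).
Hypothesis N2 : (2 <= N)%N.

Local Notation form := (multilinear_form (fun _ : 'I_N => F)).
Local Notation sym := (sym_tensor N F).
Local Notation raw := (form -> R^o).

Lemma full_map_power A (w : tensor (fun _ : 'I_N => F)) :
  range (@tensor_power R N F) w -> full_map A w \in in_span (range (@tensor_power R N F)).
Proof.
move=> [z _ <-]; apply: in_span_gen; exists (A z) => //.
exact: val_inj.
Qed.

Definition sym_map (A : {linear F -> F}) : {linear sym -> sym} :=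
  span_map (@full_map_power A).

Definition sym_ev : {linear sym -> raw} := (@full_ev R N F) \o \val.

Lemma sym_ev_at (z : F) B : sym_ev (sym_power N z) B = B (fun=> z).
Proof. by []. Qed.

Lemma sym_ev_inj (u v : sym) : (forall B, sym_ev u B = sym_ev v B) -> u = v.
Proof. by move=> uv; apply: val_inj; apply: full_ev_inj => B; exact: uv. Qed.

Lemma sym_gen (u : sym) : exists (n : nat) (c : 'I_n -> R) (i : 'I_n -> F),
  u = \sum_(j < n) c j *: sym_power N (i j).
Proof. exact: span_of_gen. Qed.

Lemma sym_ev_sum (I : finType) (f : I -> sym) B :
  sym_ev (\sum_j f j) B = \sum_j sym_ev (f j) B.
Proof. by rewrite linear_sum; elim/big_ind2: _ => // x a y b <- <-. Qed.

Definition sym_weight (x : F) : R := \prod_(s < N) `|x|.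

Lemma sym_weightE x : sym_weight x = `|x| ^+ N.
Proof. by rewrite /sym_weight prodr_const card_ord. Qed.

Lemma sym_weight_ge0 x : 0 <= sym_weight x. Proof. exact: prodr_ge0. Qed.

(** Induction on the number of slots filled with y + s e, each of which raises the degree by at most
    1. *)
Lemma mform_poly (B : form) (y e : F) : exists q : {poly R}, (size q <= N.+1)%N /\
  forall s, B (fun=> y + s *: e) = q.[s].
Proof.
suff h k (x : 'I_N -> F) : (k <= N)%N -> exists q : {poly R}, (size q <= k.+1)%N /\
    forall s, B (hybrid k x (fun=> y + s *: e)) = q.[s].
  have [q [qN qE]] := h N (fun=> 0) (leqnn N).
  by exists q; split=> // s; rewrite -qE hybridN.
elim: k x => [|k IH] x kN.
  by exists (B x)%:P; split=> [|s]; rewrite ?size_polyC ?leq_b1 // hybrid0 hornerC.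
pose k' := Ordinal kN.
have [q1 [s1 h1]] := IH (dfwith x k' y) (ltnW kN).
have [q2 [s2 h2]] := IH (dfwith x k' e) (ltnW kN).
exists (q1 + 'X * q2); split.
  rewrite (leq_trans (size_polyD _ _)) // geq_max (leq_trans s1) //=.
  have [->|q0] := eqVneq q2 0; first by rewrite mulr0 size_poly0.
  by rewrite mulrC size_mulX.
move=> s; rewrite (hybridS B _ _ k') slot_mapD slot_mapZ !hornerE -h1 -h2.
have slotE z : slot_map B (hybrid k' x (fun=> y + s *: e)) k' z =
    B (hybrid k (dfwith x k' z) (fun=> y + s *: e)).
  apply: mform_ext => j; rewrite /hybrid !dfwithE.
  by case: eqVneq => [->|//]; rewrite /= ltnn.
by rewrite !slotE.
Qed.

(* Lagrange interpolation along the line from [y] to [x] expresses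
   [x^N - y^N] through powers of points of that line, with coefficients
   that vanish linearly in the distance. *)
Lemma sym_cont : exists2 C : R, 0 < C & forall (x y : F) h,
    `|x| <= 2 -> `|y| <= 2 -> `|x - y| <= h ->
  gauge (@sym_power R N F) sym_weight (sym_power N x - sym_power N y) <= C * h.
Proof.
have hs := gauge_seminorm sym_weight_ge0 sym_gen.
pose L (l : 'I_N.+1) : {poly R} := tnth (lagrange N.+1 (fun k => k%:R : R)) l.
have /choice[D DP] l : exists D : R, 0 <= D /\
    forall s, 0 <= s <= 1 -> `|(L l).[s] - (L l).[0]| <= D * s.
  by have [D] := horner_lipschitz0 (L l); exists D.
(* The first term settles h > 1 by the triangle inequality, the sum settles h <= 1: the points y + l
   e with l <= N have norm at most 2 + N. *)
pose C := 2 * 2 ^+ N + \sum_l D l * (2 + N%:R) ^+ N.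
have S0 : 0 <= \sum_l D l * (2 + N%:R) ^+ N.
  by apply: sumr_ge0 => l _; rewrite mulr_ge0 ?exprn_ge0 ?addr_ge0 ?(DP l).1.
have p0 : 0 < 2 ^+ N :> R by rewrite exprn_gt0.
exists C => [|x y h x2 y2 xy]; first by rewrite /C; lra.
have h0 : 0 <= h := le_trans (normr_ge0 _) xy.
have [h1|h1] := leP h 1; last first.
  have pw z : `|z| <= 2 -> gauge (@sym_power R N F) sym_weight (sym_power N z) <= 2 ^+ N.
    move=> z2; rewrite (le_trans (gauge_atom sym_weight_ge0 sym_gen _)) //.
    by rewrite sym_weightE lerXn2r ?nnegrE.
  rewrite (@le_trans _ _ C) //; last by rewrite ler_peMr ?(ltW h1) // /C; lra.
  rewrite (le_trans (seminormD hs _ _)) // (seminormN hs) /C.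
  by have := pw _ x2; have := pw _ y2; lra.
have [h00|hn0] := eqVneq h 0.
  move: xy; rewrite h00 normr_le0 subr_eq0 => /eqP ->.
  by rewrite subrr (seminorm0 hs) mulr0.
have hp : 0 < h by rewrite lt_neqAle eq_sym hn0.
(* With this scaling y has parameter 0 and x parameter h, while the nodes 0, ..., N give points of
   bounded norm however small h is. *)
pose e := h^-1 *: (x - y).
have e1 : `|e| <= 1.
  by rewrite normrZ normfV [`|h|]gtr0_norm // ler_pdivrMl // mulr1.
have xE : x = y + h *: e by rewrite scalerA divff // scale1r addrC subrK.
have -> : sym_power N x - sym_power N y =
    \sum_(l < N.+1) ((L l).[h] - (L l).[0]) *: sym_power N (y + l%:R *: e).
  apply: sym_ev_inj => B; rewrite sym_ev_sum linearB.
  (* The degree bound N is uniform in B, so interpolation at N + 1 fixed nodes is exact for all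
     forms with the same coefficients. *)
  have [q [sq qE]] := mform_poly B y e.
  have inj : injective (fun k => k%:R : R) by move=> a b /eqP; rewrite eqr_nat => /eqP.
  have qL s : q.[s] = \sum_(l < N.+1) (L l).[s] * q.[l%:R].
    rewrite {1}(lagrange_gen (ltn0Sn N) inj sq) horner_sum.
    by apply: eq_bigr => l _; rewrite hornerM hornerC mulrC.
  transitivity (q.[h] - q.[0]).
    by rewrite -!qE -xE scale0r addr0.
  rewrite qL [q.[0]]qL -sumrB; apply: eq_bigr => l _.
  by rewrite -mulrBl linearZ -qE.
rewrite (le_trans (seminorm_sum hs _ _ _)) //.
rewrite (@le_trans _ _ ((\sum_l D l * (2 + N%:R) ^+ N) * h)) //; last first.
  by rewrite ler_wpM2r // /C lerDr mulr_ge0 // ltW.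
rewrite mulr_suml; apply: ler_sum => l _; rewrite (seminormZ hs) mulrAC.
apply: ler_pM => //; first exact: (seminorm_ge0 hs).
  by apply: (DP l).2; rewrite h0.
rewrite (le_trans (gauge_atom sym_weight_ge0 sym_gen _)) // sym_weightE.
rewrite lerXn2r ?nnegrE ?addr_ge0 // (le_trans (ler_normD _ _)) // lerD //.
rewrite normrZ normr_nat (@le_trans _ _ (l%:R * 1)) ?ler_wpM2l //.
by rewrite mulr1 ler_nat -ltnS.
Qed.

Definition sym_model : tensor_model N F.
Proof.
pose i0 : 'I_N := Ordinal (ltnW N2).
apply: (@TensorModel R N F sym F (fun z _ => z) (@sym_power R N F) sym_ev sym_ev_at sym_ev_inj
  sym_gen sym_map _ _ _ id).
- by [].
- by move=> A x; exists (A x).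
- by move=> x; exists (`|x|^-1 *: x).
- by [].
(* All factors coincide, so closeness to the line in the single slot i0 gives one multiple of x that
   serves every slot. *)
- move=> i x c h c1 hc; exists (c i0 *: x), (fun=> c i0); split=> // s.
- have [C C0 hC] := sym_cont; exists C => // i i' h h1 h2 h3.
  by apply: hC; [exact: h1 i0|exact: h2 i0|exact: h3 i0].
Defined.

Lemma sym_normE (u : sym) : sym_proj_norm u = gauge (@sym_power R N F) sym_weight u.
Proof.
congr inf; apply/seteqP; split=> s [n [c [x [-> ->]]]]; exists n, c, x; split=> //;
  by apply: eq_bigr => j _; rewrite sym_weightE.
Qed.

End SymmetricTensor.

Theorem theorem3 (R : realType) (N : nat) (hN : (2 <= N)%N) :
  (exists (X : 'I_N -> completeNormedModType R)
          (T : completeNormedModType R)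
          (iota : {linear tensor X -> T}),
      is_completion (@proj_norm R N X) iota /\
      exists u : T, exposed_point (@unit_ball R T) u /\
        forall x : (forall i, X i), u <> iota (pure_tensor x)) /\
  (exists (F : completeNormedModType R)
          (T : completeNormedModType R)
          (iota : {linear sym_tensor N F -> T}),
      is_completion (@sym_proj_norm R N F) iota /\
      exists u : T, exposed_point (@unit_ball R T) u /\
        forall z : F, u <> iota (sym_power N z) /\
                      u <> - iota (sym_power N z)).
Proof.
have [F [X]] := factor_space_exists R N; split.
  have [T [iota iotaP]] := completion_exists (tnorm_seminorm (full_model F hN)).
  exists (fun _ => F), T, iota; split.
    by split; [move=> u; rewrite full_normE // iotaP.1|exact: iotaP.2].
  exists (iota (witness X (full_model F hN))); split; first exact: exposed_witness.
  move=> x; rewrite -[X in _ <> X]scale1r.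
  exact: (@witness_not_elementary _ _ _ X (full_model F hN)).
have [T [iota iotaP]] := completion_exists (tnorm_seminorm (sym_model F hN)).
exists F, T, iota; split.
  by split; [move=> u; rewrite sym_normE // iotaP.1|exact: iotaP.2].
exists (iota (witness X (sym_model F hN))); split; first exact: exposed_witness.
move=> z; rewrite -scaleN1r -[X in _ <> X /\ _]scale1r.
by split; exact: (@witness_not_elementary _ _ _ X (sym_model F hN)).
Qed.
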